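(* Let $E_0,E_1,E_2$ be Banach spaces and let $b:E_0\times E_1\to E_2$ be a bilinear operator for which there is a constant $C$ such that $\|b(x,y)\|\le C\|x\|\,\|y\|$ for all $x\in E_0$, $y\in E_1$. Let $1\le p,q,r<\infty$ satisfy $\frac1p+\frac1q=\frac1r$. If $F\in\mathbb D^{1,p}(E_0)$ and $G\in\mathbb D^{1,q}(E_1)$, then $b(F,G)\in\mathbb D^{1,r}(E_2)$ and $$D[b(F,G)]=b(DF,G)+b(F,DG),$$ where $b(DF,G)h=b((DF)h,G)$ and $b(F,DG)h=b(F,(DG)h)$ for $h\in H$.
   Context: All vector spaces are real. $H$ is a separable Hilbert space, $(\Omega,\mathscr F,\mathbb P)$ is a probability space, and $W=\{W(h):h\in H\}$ is an isonormal Gaussian process on it: a (jointly) centered Gaussian family with $\mathbb E[W(h_1)W(h_2)]=\langle h_1,h_2\rangle$; $\mathscr F$ is generated by $W$. $\gamma$-radonifying operators: for $h\in H$, $x\in E$ ($E$ a Banach space), $h\otimes x$ is the operator $h'\mapsto\langle h,h'\rangle x$. For orthonormal $h_1,\dots,h_n$ put $\|\sum_j h_j\otimes x_j\|_{\gamma(H,E)}=(\mathbb E\|\sum_j\gamma_jx_j\|^2)^{1/2}$ with $(\gamma_j)$ independent standard Gaussians; $\gamma(H,E)$ is the closure of the finite rank operators in this norm. Malliavin derivative: $\mathscr S\otimes E$ is the linear span of the random variables $F=f(W(h_1),\dots,W(h_n))\otimes x$ with $f\in C_b^\infty(\mathbb R^n)$, $h_i\in H$, $x\in E$, and $DF=\sum_{i=1}^n\partial_if(W(h_1),\dots,W(h_n))\otimes(h_i\otimes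 x)$, with values in $\gamma(H,E)$. $D$ is closable from $L^p(\Omega;E)$ to $L^p(\Omega;\gamma(H,E))$ for $1\le p<\infty$; its closure is again denoted $D$, and its domain is $\mathbb D^{1,p}(E)$ with norm $(\|F\|^p_{L^p(\Omega;E)}+\|DF\|^p_{L^p(\Omega;\gamma(H,E))})^{1/p}$. *)

(* Defs.v *)
From HB Require Import structures.
From mathcomp Require Import all_boot all_order all_algebra.
From mathcomp Require Import all_classical all_reals all_analysis.

Set Implicit Arguments.
Unset Strict Implicit.
Unset Printing Implicit Defensive.

Import Order.TTheory GRing.Theory Num.Theory.
Import numFieldNormedType.Exports.

Local Open Scope classical_set_scope.
Local Open Scope ring_scope.

(* A real Hilbert space is a Banach space H together with an inner product     *)
(* ip : {dot H for idfun} that induces its norm.                               *)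
Definition induces_norm (R : realType) (H : normedModType R)
    (ip : {dot H for idfun}) : Prop :=
  forall h : H, `|h| ^+ 2 = ip h h.

Definition separable (T : topologicalType) : Prop :=
  exists2 D : set T, countable D & dense D.

Section gaussian_tuple.
Context {R : realType}.
Local Notation mR := (measurableTypeR R).

Definition cons_pair n (y : mR * n.-tuple mR) : n.+1.-tuple mR :=
  [tuple of y.1 :: y.2].

Lemma measurable_cons_pair n : measurable_fun setT (@cons_pair n).
Proof. by apply: measurable_cons. Qed.

HB.instance Definition _ n :=
  isMeasurableFun.Build _ _ _ _ (@cons_pair n) (@measurable_cons_pair n).

(* The n-fold product of N(0, 1): under it the coordinates                     *)
(* t |-> tnth t j, j < n, are independent standard Gaussians.                  *)
Fixpoint gaussian_tuple n : probability (n.-tuple mR) R :=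
  match n with
  | 0 => \d_([tuple] : 0.-tuple mR)
  | n'.+1 => distribution (normal_prob (0 : R) 1 \x gaussian_tuple n')%E
                          (@cons_pair n')
  end.

End gaussian_tuple.

Section gamma_radonifying.
Context {R : realType} {H : normedModType R} (ip : {dot H for idfun}).
Context {E : normedModType R}.

Definition orthonormal_family n (h : 'I_n -> H) : Prop :=
  forall i j, ip (h i) (h j) = (i == j)%:R.

Definition rank_one (h : H) (x : E) : H -> E := fun h' => ip h h' *: x.

(* (E || \sum_j gamma_j x_j ||^2)^(1/2) *)
Definition gaussian_norm n (x : 'I_n -> E) : \bar R :=
  Lnorm (gaussian_tuple n) 2%:E
    (fun t => (`| \sum_(j < n) (tnth t j : R) *: x j |)%:E).

Definition finite_rank_rep n (h : 'I_n -> H) (x : 'I_n -> E) (T : H -> E) :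
    Prop :=
  orthonormal_family h /\ T = \sum_(j < n) rank_one (h j) (x j).

Definition finite_rank (T : H -> E) : Prop :=
  exists n (h : 'I_n -> H) (x : 'I_n -> E), finite_rank_rep h x T.

(* By rotation invariance gaussian_norm x is the same for all representations  *)
(* of T, so the infimum is over a single value.                                *)
Definition finite_rank_norm (T : H -> E) : \bar R :=
  ereal_inf [set v | exists n (h : 'I_n -> H) (x : 'I_n -> E),
                       finite_rank_rep h x T /\ v = gaussian_norm x].

(* T is the element of the completion given by the Cauchy sequence T_: since   *)
(* || T h || <= || T ||_gamma * || h ||, the completion embeds in the bounded  *)
(* operators from H to E.                                                      *)
Definition gamma_approx (T_ : nat -> H -> E) (T : H -> E) : Prop :=
  [/\ forall k, finite_rank (T_ k),
      forall e : R, 0 < e -> exists N, forall j k, (N <= j)%N -> (N <= k)%N ->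
        (finite_rank_norm (T_ j - T_ k)%R < e%:E)%E
    & forall h, T_ k h @[k --> \oo] --> T h].

(* The infimum is again over a single value when T belongs to gamma(H, E), and *)
(* is +oo otherwise, so gamma(H, E) is {T | gamma_norm T < +oo}.               *)
Definition gamma_norm (T : H -> E) : \bar R :=
  ereal_inf [set l | exists2 T_ : nat -> H -> E, gamma_approx T_ T &
                       finite_rank_norm (T_ k) @[k --> \oo] --> l].

End gamma_radonifying.

(* Random variables with values in the normed space {v : V | N v < +oo} with   *)
(* norm N; used with V := E, N := EFin \o normr, and with V := H -> E,         *)
(* N := gamma_norm.                                                            *)
Section Lp_vector_valued.
Context {R : realType} {d : measure_display} {Omega : measurableType d}.
Variable P : probability Omega R.
Context {V : zmodType} (N : V -> \bar R).

Definition simple_map (s : Omega -> V) : Prop :=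
  [/\ finite_set (range s), forall v, measurable (s @^-1` [set v])
    & forall w, (N (s w) < +oo)%E].

Definition strongly_measurable (X : Omega -> V) : Prop :=
  (forall w, (N (X w) < +oo)%E) /\
  exists2 s : nat -> Omega -> V, forall k, simple_map (s k) &
    forall w, N (s k w - X w) @[k --> \oo] --> 0%E.

Definition Lp_norm (p : R) (X : Omega -> V) : \bar R :=
  Lnorm P p%:E (N \o X).

Definition in_Lp (p : R) (X : Omega -> V) : Prop :=
  strongly_measurable X /\ (Lp_norm p X < +oo)%E.

Definition cvg_Lp (p : R) (X_ : nat -> Omega -> V) (X : Omega -> V) : Prop :=
  Lp_norm p (X_ k - X) @[k --> \oo] --> 0%E.

End Lp_vector_valued.

Section isonormal.
Context {R : realType} {d : measure_display} {Omega : measurableType d}.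
Variable P : probability Omega R.
Context {H : normedModType R} (ip : {dot H for idfun}).
Variable W : H -> {RV P >-> R}.

(* The law of Y is N(0, s^2). The case s = 0, the Dirac mass at 0, is separate *)
(* because normal_prob has a junk value for standard deviation 0.              *)
Definition centered_gaussian (Y : Omega -> R) : Prop :=
  (exists2 s : R, s != 0 & forall B : set (measurableTypeR R), measurable B ->
     pushforward P Y B = normal_prob 0 s B) \/
  (forall B : set (measurableTypeR R), measurable B ->
     pushforward P Y B = \d_(0 : R) B).

Definition isonormal : Prop :=
  (forall n (c : 'I_n -> R) (h : 'I_n -> H),
     centered_gaussian (fun w => \sum_(i < n) c i * W (h i) w)) /\
  (forall h1 h2, 'E_P[W h1 \* W h2] = (ip h1 h2)%:E)%E.

Definition generated_by_W : Prop :=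
  (measurable : set (set Omega)) =
  <<s [set A | exists h (B : set (measurableTypeR R)),
                 measurable B /\ A = W h @^-1` B] >>.

End isonormal.

Section smooth_functions.
Context {R : realType} {n : nat}.

Definition partial (i : 'I_n) (f : 'rV[R]_n -> R) : 'rV[R]_n -> R :=
  fun a => 'D_(delta_mx 0 i) f a.

Definition iter_partial (s : seq 'I_n) (f : 'rV[R]_n -> R) : 'rV[R]_n -> R :=
  foldr partial f s.

(* f and all its partial derivatives, of any order, exist, are continuous and  *)
(* are bounded.                                                                *)
Definition Cb_infty (f : 'rV[R]_n -> R) : Prop :=
  forall s : seq 'I_n,
    [/\ continuous (iter_partial s f),
        bounded_fun (iter_partial s f)
      & forall (i : 'I_n) a, derivable (iter_partial s f) a (delta_mx 0 i)].

End smooth_functions.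

Section malliavin.
Context {R : realType} {d : measure_display} {Omega : measurableType d}.
Variable P : probability Omega R.
Context {H : normedModType R} (ip : {dot H for idfun}).
Variable W : H -> {RV P >-> R}.
Context {E : normedModType R}.

Definition W_vector n (h : 'I_n -> H) (w : Omega) : 'rV[R]_n :=
  \row_i W (h i) w.

(* F = f(W(h_1), ..., W(h_n)) (x) x and X = DF *)
Definition elementary_derivative (F : Omega -> E) (X : Omega -> H -> E) : Prop :=
  exists n (h : 'I_n -> H) (f : 'rV[R]_n -> R) (x : E),
    [/\ Cb_infty f,
        F = (fun w => f (W_vector h w) *: x)
      & X = (fun w => \sum_(i < n)
               partial i f (W_vector h w) *: rank_one ip (h i) x)].

(* F belongs to S (x) E and X = DF. Finite sums give the whole linear span, as *)
(* scalars are absorbed by x.                                                  *)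
Definition smooth_derivative (F : Omega -> E) (X : Omega -> H -> E) : Prop :=
  exists m (F_ : 'I_m -> Omega -> E) (X_ : 'I_m -> Omega -> H -> E),
    [/\ forall k, elementary_derivative (F_ k) (X_ k),
        F = \sum_(k < m) F_ k & X = \sum_(k < m) X_ k].

Definition banach_norm (x : E) : \bar R := `|x|%:E.

(* The graph of the closure of D : L^p(Omega; E) -> L^p(Omega; gamma(H, E)):   *)
(* F belongs to D^{1,p}(E) and DF = X. Elements of L^p are represented by      *)
(* strongly measurable functions.                                              *)
Definition malliavin_derivative (p : R) (F : Omega -> E) (X : Omega -> H -> E) :
    Prop :=
  [/\ in_Lp P banach_norm p F,
      in_Lp P (gamma_norm ip) p X
    & exists (F_ : nat -> Omega -> E) (X_ : nat -> Omega -> H -> E),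
        [/\ forall k, smooth_derivative (F_ k) (X_ k),
            cvg_Lp P banach_norm p F_ F
          & cvg_Lp P (gamma_norm ip) p X_ X]].

End malliavin.

(* Main.v *)
Require Import Defs.
From HB Require Import structures.
From mathcomp Require Import all_boot all_order all_algebra.
From mathcomp Require Import all_classical all_reals all_analysis.
From mathcomp Require Import measurable_realfun ring lra.

Set Implicit Arguments.
Unset Strict Implicit.
Unset Printing Implicit Defensive.

Import Order.TTheory GRing.Theory Num.Theory.
Import numFieldNormedType.Exports.

Local Open Scope classical_set_scope.
Local Open Scope ring_scope.

(* For F = f(W(h)) x and G = g(W(k)) y the random variable b(F, G) is          *)
(* (f (x) g)(W(h, k)) b(x, y), so the Leibniz rule for smooth random variables *)
(* is the product rule for the partial derivatives of f (x) g. The general     *)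
(* case follows by closing the graph: the maps (x, y) |-> b(x, y),             *)
(* (T, y) |-> b(T(.), y) and (x, T) |-> b(x, T(.)) are bounded by C for the    *)
(* Banach and gamma norms, hence, by Hoelder's inequality, continuous from     *)
(* L^p x L^q to L^r.                                                           *)
(* That the gamma norm is a norm rests on the invariance of the standard       *)
(* Gaussian measure under isometries: it makes the norm of a finite rank       *)
(* operator independent of the orthonormal family, so that two operators can   *)
(* be expanded along a common one. Isometries are reduced to plane rotations   *)
(* acting on two coordinates.                                                  *)

(** * Isometry invariance of the standard Gaussian measure *)

(** The derivative is a closed operator by construction, so the Leibniz rule only has to hold on a
    core and to survive limits. Take smooth [F_ k], [G_ k] whose values and derivatives converge in
    $L^p$ and in $L^q$. For these, [smooth_leibniz] is an exact identity: both sides are bilinear,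
    and for elementary variables the two factors depend on separate blocks of coordinates. In the
    limit, a difference of products $B(x',y')-B(x,y)$ is the sum of $B(x'-x,y'-y)$, $B(x'-x,y)$ and
    $B(x,y'-y)$, and Hoelder's inequality with $1/p+1/q=1/r$ sends each term to 0 in $L^r$. This is
    [cvg_Lp_bilinear], stated for arbitrary extended seminorms and applied three times: to $b(F,G)$,
    $b(DF,G)$ and $b(F,DG)$.

    What it asks of the gamma norm is the ideal property [gamma_norm_comp] (composition with a
    bounded operator) and the triangle inequality [gamma_normD]. Both pass from finite rank
    operators to limits. For finite rank, [finite_rank_normE] lets two operators be written along
    one orthonormal family, where the triangle inequality is Minkowski's in $L^2$ of a Gaussian
    vector; it rests on [integral_gaussian_isometry]. *)

Section gaussian_plane.
Context {R : realType}.
Local Notation mR := (measurableTypeR R).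
Local Notation mu := (@lebesgue_measure R).
Local Notation nu := (normal_prob (0 : R) 1).
Local Notation phi := (normal_pdf (0 : R) 1).
Local Open Scope ereal_scope.

(** The Radon-Nikodym derivative of the normal law and the explicit density [phi] have the same
    integral over every measurable set, so they agree almost everywhere. *)
Lemma integral_normal_prob (f : mR -> \bar R) :
  measurable_fun setT f -> (forall x, 0 <= f x) ->
  \int[nu]_x f x = \int[mu]_x (f x * (phi x)%:E).
Proof.
move=> mf f0.
rewrite -(@Radon_Nikodym_SigmaFinite.change_of_variables _ _ _ nu mu)//; last first.
  exact: normal_prob_dominates.
have int_d := Radon_Nikodym_SigmaFinite.f_integrable (normal_prob_dominates (0:R) 1).
have md : measurable_fun setT (Radon_Nikodym_SigmaFinite.f nu mu).
  exact: (measurable_int mu).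
have mphi : measurable_fun setT (fun x : mR => (phi x)%:E).
  by apply/measurable_EFinP; exact: measurable_normal_pdf.
apply: ae_eq_integral => //.
- exact: emeasurable_funM.
- exact: emeasurable_funM.
suff : ae_eq mu setT (Radon_Nikodym_SigmaFinite.f nu mu) (fun x => (phi x)%:E).
  by apply: filterS => x /= /[apply] ->.
apply: integral_ae_eq => // A _ mA.
by rewrite -Radon_Nikodym_SigmaFinite.f_integral//; exact: normal_prob_dominates.
Qed.

(** A translation preserves the length of half-open intervals, and these determine Lebesgue
    measure. *)
Lemma lebesgue_measureD (a : R) (A : set mR) : measurable A ->
  pushforward mu (fun x : mR => (x + a)%R : mR) A = mu A.
Proof.
have ma : measurable_fun setT (fun x : mR => (x + a)%R : mR).
  exact: measurable_funD.
pose phiM := isMeasurableFun.Build _ _ _ _ _ ma.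
pose phiP : {mfun mR >-> mR} := HB.pack (fun x : mR => (x + a)%R : mR) phiM.
move=> mA; apply/esym/(@lebesgue_measure_unique _ (pushforward mu phiP)) => //= _ [[b c]] _ <-.
rewrite /pushforward/=.
rewrite (_ : _ @^-1` _ = `](b - a)%R, (c - a)%R]%classic); last first.
  by apply/seteqP; split => x /=; rewrite !in_itv/= ltrBlDr lerBrDr.
rewrite !lebesgue_measure_itv/= !lte_fin ltrD2r -!EFinB.
by case: ifPn => // _; congr EFin; rewrite opprD addrACA subrr addr0.
Qed.

Lemma integral_lebesgueD (a : R) (f : mR -> \bar R) :
  measurable_fun setT f -> (forall x, 0 <= f x) ->
  \int[mu]_x f (x + a)%R = \int[mu]_x f x.
Proof.
move=> mf f0.
have ma : measurable_fun setT (fun x : mR => (x + a)%R : mR).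
  exact: measurable_funD.
have := ge0_integral_pushforward ma mu measurableT mf (fun x _ => f0 x).
rewrite preimage_setT/= => <-.
by apply: eq_measure_integral => A mA _; exact: (lebesgue_measureD a mA).
Qed.

(** The density is even. This covers the reflections among the isometries, which rotations do not
    reach. *)
Lemma integral_normalN (f : mR -> \bar R) :
  measurable_fun setT f -> (forall x, 0 <= f x) ->
  \int[nu]_x f (- x)%R = \int[nu]_x f x.
Proof.
move=> mf f0.
have mN : measurable_fun setT (-%R : mR -> mR) by [].
rewrite !integral_normal_prob//; last exact: measurableT_comp.
have mphi : measurable_fun setT (fun x : mR => (phi x)%:E).
  by apply/measurable_EFinP; exact: measurable_normal_pdf.
under eq_integral => x _.
  rewrite (_ : phi x = phi (- x)%R); last first.
    by rewrite !normal_pdfE ?oner_neq0// /normal_fun !subr0 sqrrN.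
  over.
have mg : measurable_fun setT (fun x : mR => f x * (phi x)%:E).
  exact: emeasurable_funM.
have g0 x : 0 <= f x * (phi x)%:E.
  by rewrite mule_ge0// lee_fin normal_pdf_ge0.
have := ge0_integral_pushforward mN mu measurableT mg (fun x _ => g0 x).
rewrite preimage_setT/= => <-.
by apply: eq_measure_integral => A mA _; exact: (lebesgue_measureN mA).
Qed.

Let dint (m : {sigma_finite_measure set mR -> \bar R}) (f : mR * mR -> \bar R) :=
  \int[m]_x \int[m]_y f (x, y).

Let shear1 (a : R) (z : mR * mR) : mR * mR := ((z.1 + a * z.2)%R, z.2).
Let shear2 (a : R) (z : mR * mR) : mR * mR := (z.1, (z.2 + a * z.1)%R).

Let measurable_shear1 a : measurable_fun setT (shear1 a).
Proof.
apply: measurable_fun_pair => //; apply: measurable_funD => //.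
by apply: measurable_funM => //.
Qed.

Let measurable_shear2 a : measurable_fun setT (shear2 a).
Proof.
apply: measurable_fun_pair => //; apply: measurable_funD => //.
by apply: measurable_funM => //.
Qed.

Let dint_shear2 a f : measurable_fun setT f -> (forall z, 0 <= f z) ->
  dint mu (f \o shear2 a) = dint mu f.
Proof.
move=> mf f0; apply: eq_integral => x _.
rewrite -[RHS](integral_lebesgueD (a * x))//.
exact: measurableT_comp.
Qed.

(** Once Tonelli has put the first coordinate inside, the shear is a translation of the inner
    variable. *)
Let dint_shear1 a f : measurable_fun setT f -> (forall z, 0 <= f z) ->
  dint mu (f \o shear1 a) = dint mu f.
Proof.
move=> mf f0.
have mfs := measurableT_comp mf (measurable_shear1 a).
rewrite /dint [LHS](fubini_tonelli _ mfs (fun z => f0 _)).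
rewrite [RHS](fubini_tonelli _ mf f0); apply: eq_integral => y _.
rewrite -[RHS](integral_lebesgueD (a * y))//.
exact: measurableT_comp.
Qed.

Let dint_nu f : measurable_fun setT f -> (forall z, 0 <= f z) ->
  dint nu f = dint mu (fun z => f z * ((phi z.1)%:E * (phi z.2)%:E)).
Proof.
move=> mf f0.
have mphi : measurable_fun setT (fun x : mR => (phi x)%:E).
  by apply/measurable_EFinP; exact: measurable_normal_pdf.
rewrite /dint integral_normal_prob; last 2 first.
- by apply: (measurable_fun_fubini_tonelli_F (m2 := nu) f).
- by move=> x; exact: integral_ge0.
apply: eq_integral => x _.
have mfx : measurable_fun setT (fun y => f (x, y)) by exact: measurableT_comp.
rewrite integral_normal_prob//.
rewrite -ge0_integralZr//.
- by apply: eq_integral => y _ /=; rewrite muleAC muleA.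
- exact: emeasurable_funM.
- by move=> y _; rewrite mule_ge0// lee_fin normal_pdf_ge0.
- by rewrite lee_fin normal_pdf_ge0.
Qed.

(* A rotation by an angle that is not a multiple of pi is a product of three *)
(* shears, each of which preserves the plane Lebesgue measure.               *)
Lemma integral_normal_rotation (c s : R) (f : mR * mR -> \bar R) :
  (s != 0)%R -> (c ^+ 2 + s ^+ 2 = 1)%R ->
  measurable_fun setT f -> (forall z, 0 <= f z) ->
  \int[nu]_x \int[nu]_y f ((c * x - s * y)%R, (s * x + c * y)%R) =
  \int[nu]_x \int[nu]_y f (x, y).
Proof.
move=> s0 cs mf f0.
pose rot (z : mR * mR) : mR * mR := ((c * z.1 - s * z.2)%R, (s * z.1 + c * z.2)%R).
have mrot : measurable_fun setT rot.
  apply: measurable_fun_pair.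
    by apply: measurable_funB; apply: measurable_funM.
  by apply: measurable_funD; apply: measurable_funM.
have mphi : measurable_fun setT (fun x : mR => (phi x)%:E).
  by apply/measurable_EFinP; exact: measurable_normal_pdf.
pose g z := f z * ((phi z.1)%:E * (phi z.2)%:E).
have mg : measurable_fun setT g.
  apply: emeasurable_funM => //.
  apply: emeasurable_funM.
    exact: (measurableT_comp mphi measurable_fst).
  exact: (measurableT_comp mphi measurable_snd).
have g0 z : 0 <= g z by rewrite mule_ge0// mule_ge0// lee_fin normal_pdf_ge0.
rewrite -[LHS]/(dint nu (f \o rot)) -[RHS]/(dint nu f) (dint_nu mf f0).
rewrite (dint_nu (measurableT_comp mf mrot) (fun z => f0 (rot z))).
(* For $c=\cos t$ and $s=\sin t$ this is $-\tan(t/2)$, the coefficient of the two outer shears in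
   the classical factorization of a rotation. *)
pose a := ((c - 1) / s)%R.
have rotE : rot = shear1 a \o shear2 s \o shear1 a.
  apply/funext => -[x y]; rewrite /rot /shear1 /shear2/= /a; congr pair.
    have -> : (c * x - s * y = c * x + (c ^+ 2 - 1) / s * y)%R.
      have -> : (c ^+ 2 - 1 = - s ^+ 2)%R by rewrite -cs opprD addrA subrr add0r.
      by field.
    by field.
  by field.
(* The product density depends only on $x^2+y^2$, so it may be composed with [rot] for free. *)
transitivity (dint mu (g \o rot)).
  congr (dint mu _); apply/funext => -[x y]; rewrite /g /=; congr (_ * _).
  rewrite !normal_pdfE ?oner_neq0// /normal_fun !subr0 -!EFinM; congr EFin.
  rewrite !mulrA ![(normal_peak 1 * _ * normal_peak 1)%R]mulrAC -!mulrA -!expRD.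
  congr (_ * (_ * expR _))%R; rewrite -!mulrDl; congr (_ / _)%R.
  have -> : (- x ^+ 2 - y ^+ 2 = - ((c ^+ 2 + s ^+ 2) * (x ^+ 2 + y ^+ 2)))%R.
    by rewrite cs mul1r opprD.
  by ring.
have mg2 := measurableT_comp mg (measurable_shear1 a).
have mg3 := measurableT_comp mg2 (measurable_shear2 s).
rewrite rotE -[RHS](dint_shear1 a mg g0).
rewrite -[RHS](dint_shear2 s mg2 (fun z => g0 _)).
by rewrite -[RHS](dint_shear1 a mg3 (fun z => g0 _)).
Qed.

End gaussian_plane.

(** * Gaussian vectors in n dimensions and orthogonal matrices *)

Section gaussian_tuple_invariance.
Context {R : realType}.
Local Notation mR := (measurableTypeR R).
Local Notation nu := (normal_prob (0 : R) 1).
Local Open Scope ereal_scope.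

Lemma integral_gaussian_tuple0 (f : 0.-tuple mR -> \bar R) :
  \int[gaussian_tuple 0]_t f t = f [tuple].
Proof.
rewrite (eq_integral (cst (f [tuple]))); last by move=> t _; rewrite [t]tuple0.
by rewrite integral_cst//= diracT mule1.
Qed.

Lemma integral_gaussian_tupleS n (f : n.+1.-tuple mR -> \bar R) :
  measurable_fun setT f -> (forall t, 0 <= f t) ->
  \int[gaussian_tuple n.+1]_t f t =
  \int[nu]_x \int[gaussian_tuple n]_t f (cons_pair (x, t)).
Proof.
move=> mf f0.
rewrite (ge0_integral_distribution (@cons_pair R n : {mfun _ >-> _}) mf f0).
have mfc := measurableT_comp mf (@measurable_cons_pair R n).
exact: (fubini_tonelli1 _ mfc (fun z => f0 _)).
Qed.

Lemma measurable_integral_cons n (f : n.+1.-tuple mR -> \bar R) :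
  measurable_fun setT f -> (forall t, 0 <= f t) ->
  measurable_fun setT (fun x : mR => \int[gaussian_tuple n]_t f (cons_pair (x, t))).
Proof.
move=> mf f0.
have mfc := measurableT_comp mf (@measurable_cons_pair R n).
exact: (measurable_fun_fubini_tonelli_F (m2 := gaussian_tuple n) _ mfc (fun z => f0 _)).
Qed.

(** Tuples are row vectors multiplied on the right, so [A *m B] acts by [A] first. Rectangular [A]
    are allowed because two representations of an operator may differ in length. *)
Definition mulmx_tuple N n (A : 'M[R]_(N, n)) (t : N.-tuple mR) : n.-tuple mR :=
  [tuple (\sum_(i < N) (tnth t i : R) * A i j)%R | j < n].

Lemma measurable_mulmx_tuple N n (A : 'M[R]_(N, n)) :
  measurable_fun setT (mulmx_tuple A).
Proof.
apply/measurable_fun_tnthP => j.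
rewrite (_ : _ \o _ = fun t => \sum_(i < N) (tnth t i : R) * A i j)%R; last first.
  by apply/funext => t /=; rewrite tnth_mktuple.
apply: measurable_sum => i; apply: measurable_funM => //.
exact: measurable_tnth.
Qed.

Lemma mulmx_tupleM N m n (A : 'M[R]_(N, m)) (B : 'M[R]_(m, n)) t :
  mulmx_tuple (A *m B) t = mulmx_tuple B (mulmx_tuple A t).
Proof.
apply: eq_from_tnth => j; rewrite !tnth_mktuple.
under eq_bigr do rewrite mxE big_distrr/=.
rewrite exchange_big/=; apply: eq_bigr => k _.
rewrite tnth_mktuple big_distrl/=.
by apply: eq_bigr => i _; rewrite mulrA.
Qed.

Lemma mulmx_tuple1 N (t : N.-tuple mR) : mulmx_tuple 1%:M t = t.
Proof.
apply: eq_from_tnth => j; rewrite !tnth_mktuple (bigD1 j)//= mxE eqxx mulr1.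
rewrite big1 ?addr0// => i ij; rewrite mxE (negbTE ij) mulr0//.
Qed.

Lemma tnth_cons_pairl n (x : mR) (t : n.-tuple mR) (i : 'I_1) :
  tnth (cons_pair (x, t)) (lshift n i : 'I_n.+1) = x.
Proof. by rewrite (ord1 i) (_ : lshift n ord0 = ord0) ?tnth0//; exact: val_inj. Qed.

Lemma tnth_cons_pairr n (x : mR) (t : n.-tuple mR) (i : 'I_n) :
  tnth (cons_pair (x, t)) (rshift 1 i : 'I_n.+1) = tnth t i.
Proof. by rewrite (_ : rshift 1 i = lift ord0 i) ?tnthS//; exact: val_inj. Qed.

Lemma mulmx_tuple_block N n (a : R) (D : 'M[R]_(N, n)) (x : mR) t :
  mulmx_tuple (block_mx a%:M 0 0 D : 'M[R]_(1 + N, 1 + n)) (cons_pair (x, t)) =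
  cons_pair ((x * a)%R : mR, mulmx_tuple D t).
Proof.
apply: eq_from_tnth => j; rewrite tnth_mktuple (@big_split_ord _ _ _ 1 N) big_ord1.
rewrite tnth_cons_pairl.
under eq_bigr do rewrite tnth_cons_pairr.
case: (split_ordP (j : 'I_(1 + n))) => k ->.
  rewrite tnth_cons_pairl block_mxEul (ord1 k) mxE eqxx mulr1n.
  rewrite big1 => [|i _]; first exact: addr0.
  by rewrite block_mxEdl mxE mulr0.
rewrite tnth_cons_pairr block_mxEur mxE mulr0 [LHS]add0r tnth_mktuple.
by apply: eq_bigr => i _; rewrite block_mxEdr.
Qed.

(** Orthogonality is kept next to invariance because the reduction of [A] to block form uses both:
    one to keep the columns of [Q *m A] orthonormal, the other to insert [Q] into the integral. *)
Definition gaussian_invariant N (Q : 'M[R]_N) : Prop :=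
  (Q^T *m Q = 1%:M)%R /\
  forall f : N.-tuple mR -> \bar R,
    measurable_fun setT f -> (forall t, 0 <= f t) ->
    \int[gaussian_tuple N]_t f (mulmx_tuple Q t) = \int[gaussian_tuple N]_t f t.

Lemma gaussian_invariant1 N : gaussian_invariant (1%:M : 'M[R]_N).
Proof.
split; first by rewrite trmx1 mulmx1.
by move=> f _ _; apply: eq_integral => t _; rewrite mulmx_tuple1.
Qed.

Lemma gaussian_invariantM N (A B : 'M[R]_N) :
  gaussian_invariant A -> gaussian_invariant B -> gaussian_invariant (A *m B).
Proof.
move=> [AA iA] [BB iB]; split.
  by rewrite trmx_mul mulmxA -(mulmxA B^T) AA mulmx1.
move=> f mf f0; rewrite -(iB f mf f0).
have mfB := measurableT_comp mf (measurable_mulmx_tuple B).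
rewrite -(iA _ mfB (fun t => f0 _)).
by apply: eq_integral => t _ /=; rewrite mulmx_tupleM.
Qed.

Lemma gaussian_invariant_block N (Q : 'M[R]_N) :
  gaussian_invariant Q ->
  gaussian_invariant (block_mx 1%:M 0 0 Q : 'M[R]_(1 + N)).
Proof.
move=> [QQ iQ]; split.
  rewrite tr_block_mx mulmx_block !trmx0 !mul0mx !mulmx0 trmx1 mulmx1 QQ.
  by rewrite !addr0 add0r -scalar_mx_block.
move=> f mf f0.
have mfQ := measurableT_comp mf (measurable_mulmx_tuple (block_mx 1%:M 0 0 Q : 'M[R]_(1 + N))).
rewrite (integral_gaussian_tupleS mfQ (fun t => f0 _)) (integral_gaussian_tupleS mf f0).
apply: eq_integral => x _.
have mfx : measurable_fun setT (fun t => f (cons_pair (x, t))).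
  exact: (measurableT_comp mf (measurableT_comp (@measurable_cons_pair R N) (measurable_pair1 x))).
rewrite -(iQ _ mfx (fun t => f0 _)); apply: eq_integral => t _ /=.
by rewrite mulmx_tuple_block mulr1.
Qed.

(** Rows are [(c, s)] and [(- s, c)]: acting on row vectors it is the rotation of
    [integral_normal_rotation]. *)
Definition rotation2 (c s : R) : 'M[R]_2 :=
  \matrix_(i < 2, j < 2) (if i == j then c else if i == 0%R then s else - s)%R.

Let ord2P (P : 'I_2 -> Prop) : P 0%R -> P 1%R -> forall i, P i.
Proof.
move=> P0 P1 [[|[|//]] i].
  by rewrite (_ : Ordinal i = 0%R)//; exact: val_inj.
by rewrite (_ : Ordinal i = 1%R)//; exact: val_inj.
Qed.

Lemma rotation2_orthogonal (c s : R) : (c ^+ 2 + s ^+ 2 = 1)%R ->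
  ((rotation2 c s)^T *m rotation2 c s = 1%:M)%R.
Proof.
move=> cs; apply/matrixP; apply: ord2P; apply: ord2P;
  by rewrite !mxE !big_ord_recl big_ord0 !mxE/= -?cs; ring.
Qed.

(** Integrating out all coordinates but the first two leaves a function [g] on the plane, to which
    the plane rotation invariance applies. *)
Lemma gaussian_invariant_rotation N (c s : R) :
  (s != 0)%R -> (c ^+ 2 + s ^+ 2 = 1)%R ->
  gaussian_invariant (block_mx (rotation2 c s) 0 0 1%:M : 'M[R]_(2 + N)).
Proof.
move=> s0 cs; split.
  rewrite tr_block_mx mulmx_block !trmx0 !mul0mx !mulmx0 trmx1 mulmx1.
  by rewrite rotation2_orthogonal// !addr0 add0r -scalar_mx_block.
set Q := block_mx _ _ _ _.
have QE x y (t : N.-tuple mR) :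
    mulmx_tuple Q (cons_pair (x, cons_pair (y, t))) =
    cons_pair ((c * x - s * y)%R : mR, cons_pair ((s * x + c * y)%R : mR, t)).
  have t0 (x' y' : mR) : tnth (cons_pair (x', cons_pair (y', t))) (lshift N (0%R : 'I_2)) = x'.
    by rewrite (_ : lshift N (0%R : 'I_2) = ord0 :> 'I_N.+2) ?tnth0//; exact: val_inj.
  have t1 (x' y' : mR) : tnth (cons_pair (x', cons_pair (y', t))) (lshift N (1%R : 'I_2)) = y'.
    rewrite (_ : lshift N (1%R : 'I_2) = lift ord0 ord0 :> 'I_N.+2); last exact: val_inj.
    by rewrite tnthS tnth0.
  have t2 (x' y' : mR) i : tnth (cons_pair (x', cons_pair (y', t))) (rshift 2 i) = tnth t i.
    by rewrite (_ : rshift 2 i = lift ord0 (lift ord0 i) :> 'I_N.+2) ?tnthS//; exact: val_inj.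
  apply: eq_from_tnth => j; rewrite tnth_mktuple (@big_split_ord _ _ _ 2 N)/=.
  rewrite !big_ord_recl big_ord0/=.
  rewrite (_ : lift ord0 ord0 = 1%R :> 'I_2); last exact: val_inj.
  rewrite t0 t1; under eq_bigr do rewrite t2.
  case: (split_ordP (j : 'I_(2 + N))) => k ->.
    rewrite [X in (_ + X)%R]big1 => [|i _]; last by rewrite block_mxEdl mxE mulr0.
    rewrite !block_mxEul !mxE; move: k; apply: ord2P; rewrite ?t0 ?t1/=; ring.
  rewrite t2 !block_mxEur !mxE !mulr0 !add0r.
  rewrite (bigD1 k)//= block_mxEdr mxE eqxx mulr1 big1 ?addr0// => i ik.
  by rewrite block_mxEdr mxE (negbTE ik) mulr0.
move=> f mf f0.
have mfQ := measurableT_comp mf (measurable_mulmx_tuple Q).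
pose g (z : mR * mR) := \int[gaussian_tuple N]_t f (cons_pair (z.1, cons_pair (z.2, t))).
have mcons : measurable_fun setT (fun z : (mR * mR) * N.-tuple mR =>
    cons_pair (z.1.1, cons_pair (z.1.2, z.2))).
  apply: (measurableT_comp (@measurable_cons_pair R N.+1)).
  apply: measurable_fun_pair; first exact: (measurableT_comp measurable_fst measurable_fst).
  apply: (measurableT_comp (@measurable_cons_pair R N)).
  apply: measurable_fun_pair; first exact: (measurableT_comp measurable_snd measurable_fst).
  exact: measurable_snd.
have mg : measurable_fun setT g.
  exact: (measurable_fun_fubini_tonelli_F (m2 := gaussian_tuple N) _
    (measurableT_comp mf mcons) (fun z => f0 _)).
have g0 z : 0 <= g z by exact: integral_ge0.
have cons2E (h : N.+2.-tuple mR -> \bar R) : measurable_fun setT h -> (forall t, 0 <= h t) ->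
    \int[gaussian_tuple N.+2]_t h t =
    \int[nu]_x \int[nu]_y \int[gaussian_tuple N]_t h (cons_pair (x, cons_pair (y, t))).
  move=> mh h0; rewrite (integral_gaussian_tupleS mh h0); apply: eq_integral => x _.
  have mhx : measurable_fun setT (fun t => h (cons_pair (x, t))).
    exact: (measurableT_comp mh (measurableT_comp (@measurable_cons_pair R _) (measurable_pair1 x))).
  by rewrite (integral_gaussian_tupleS mhx (fun t => h0 _)).
rewrite (cons2E _ mfQ (fun t => f0 _)) (cons2E _ mf f0).
rewrite -[RHS]/(\int[nu]_x \int[nu]_y g (x, y)).
rewrite -(integral_normal_rotation s0 cs mg g0).
apply: eq_integral => x _; apply: eq_integral => y _; apply: eq_integral => t _.
by rewrite /= QE.
Qed.

(** Elimination by Givens rotations: the induction hypothesis clears the entries of [v] below the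
    second one, and a rotation of the first two coordinates clears the second. *)
Lemma gaussian_invariant_reduce N (v : 'cV[R]_N.+1) :
  exists2 Q, gaussian_invariant Q & exists c, (Q *m v = c *: delta_mx 0 0)%R.
Proof.
elim: N v => [|N IH] v.
  exists 1%:M; first exact: gaussian_invariant1.
  exists (v 0 0)%R; rewrite mul1mx; apply/matrixP => i j.
  by rewrite !mxE !ord1 eqxx mulr1.
have [Q1 iQ1 [c Q1v]] := IH (dsubmx (v : 'cV_(1 + N.+1)))%R.
have := gaussian_invariant_block iQ1; set Q2 : 'M[R]_(1 + N.+1) := block_mx _ _ _ _ => iQ2.
pose a := (v 0 0)%R.
pose w : 'cV[R]_(2 + N) := (Q2 *m (v : 'cV_(1 + N.+1)))%R.
have wE : w = col_mx a%:M (c *: delta_mx 0 0)%R :> 'cV_(1 + N.+1).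
  rewrite /w /Q2 -[X in _ *m X](@vsubmxK _ 1 N.+1) mul_block_col mul1mx !mul0mx addr0 add0r Q1v.
  congr col_mx; apply/matrixP => i j; rewrite !mxE !ord1 eqxx mulr1n /a.
  by congr (v _ _); exact: val_inj.
have w0 : w (lshift N (0%R : 'I_2)) 0%R = a.
  rewrite wE (_ : lshift N (0%R : 'I_2) = lshift N.+1 (0%R : 'I_1) :> 'I_N.+2); last exact: val_inj.
  by rewrite [LHS](@col_mxEu _ 1 N.+1) mxE eqxx mulr1n.
have w1 : w (lshift N (1%R : 'I_2)) 0%R = c.
  rewrite wE (_ : lshift N (1%R : 'I_2) = rshift 1 (0%R : 'I_N.+1) :> 'I_N.+2); last exact: val_inj.
  by rewrite [LHS](@col_mxEd _ 1 N.+1) !mxE eqxx mulr1.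
have w2 i : w (rshift 2 i) 0%R = 0%R.
  rewrite wE (_ : rshift 2 i = rshift 1 (rshift 1 i : 'I_N.+1) :> 'I_N.+2); last exact: val_inj.
  by rewrite [LHS](@col_mxEd _ 1 N.+1) !mxE mulr0.
(* If [c = 0] the column is already reduced; this case is separate because the invariance under
   rotations is available only for a nonzero sine, here [c / r]. *)
have [c0|c0] := eqVneq c 0%R.
  exists Q2 => //; exists a; rewrite -/w wE c0 scale0r.
  apply/matrixP => i j; rewrite !ord1.
  case: (split_ordP (i : 'I_(1 + N.+1))) => k ->.
    rewrite [LHS](@col_mxEu _ 1 N.+1) !mxE !ord1 (_ : lshift N.+1 (0%R : 'I_1) = 0%R :> 'I_N.+2); last exact: val_inj.
    by rewrite !eqxx mulr1.
  by rewrite [LHS](@col_mxEd _ 1 N.+1) !mxE mulr0.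
pose r := Num.sqrt (a ^+ 2 + c ^+ 2).
have r2 : (r ^+ 2 = a ^+ 2 + c ^+ 2)%R by rewrite sqr_sqrtr// addr_ge0// sqr_ge0.
have r0 : r != 0%R.
  by rewrite -sqrf_eq0 r2 gt_eqF// ltr_wpDl ?sqr_ge0// lt0r sqr_ge0 sqrf_eq0 c0.
exists ((block_mx (rotation2 (a / r) (c / r)) 0 0 1%:M : 'M[R]_(2 + N)) *m Q2)%R.
  apply: gaussian_invariantM => //; apply: gaussian_invariant_rotation.
    by rewrite mulf_neq0// invr_eq0.
  by rewrite !expr_div_n -mulrDl -r2 mulfV// sqrf_eq0.
exists r; rewrite -mulmxA -/w; apply/matrixP => i j; rewrite !ord1 mxE.
rewrite (@big_split_ord _ _ _ 2 N)/= !big_ord_recl big_ord0/=.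
rewrite (_ : lift ord0 ord0 = 1%R :> 'I_2); last exact: val_inj.
rewrite [X in (_ + X)%R]big1 => [|k _]; last by rewrite w2 mulr0.
rewrite w0 w1; case: (split_ordP (i : 'I_(2 + N))) => k ->.
  rewrite !(@block_mxEul _ 2 N 2 N) !mxE; move: k; apply: ord2P => /=.
    rewrite mulr1 !addr0 -[RHS](mulfK r0) -expr2 r2.
    by field.
  by rewrite mulr0; field.
by rewrite !(@block_mxEdl _ 2 N 2 N) !mxE !mul0r !add0r/= mulr0.
Qed.

(* Left multiplication by an invariant Q sends the first column of A to +-e_0; *)
(* orthogonality then makes Q A block diagonal, and the induction goes on.     *)
Theorem integral_gaussian_isometry N n (A : 'M[R]_(N, n))
    (f : n.-tuple mR -> \bar R) : (A^T *m A = 1%:M)%R ->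
  measurable_fun setT f -> (forall t, 0 <= f t) ->
  \int[gaussian_tuple N]_t f (mulmx_tuple A t) = \int[gaussian_tuple n]_t f t.
Proof.
elim: n N A f => [|n IH] N A f AA mf f0.
  rewrite integral_gaussian_tuple0.
  rewrite (eq_integral (cst (f [tuple]))); last by move=> t _ /=; rewrite [mulmx_tuple _ _]tuple0.
  by rewrite integral_cst//= probability_setT mule1.
(* With no rows, [A^T *m A] would be zero, so [N] is positive. *)
case: N => [|N] in A AA *.
  move/matrixP : AA => /(_ ord0 ord0)/eqP; rewrite !mxE big_ord0 eqxx/=.
  by rewrite eq_sym oner_eq0.
have [Q [QQ iQ] [c Qc]] := gaussian_invariant_reduce (col ord0 A).
pose B : 'M[R]_(1 + N, 1 + n) := (Q *m A)%R.
have BB : (B^T *m B = 1%:M)%R.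
  by rewrite /B trmx_mul mulmxA -(mulmxA A^T) QQ mulmx1.
have dlB : dlsubmx B = 0%R.
  apply/matrixP => i j; rewrite (ord1 j).
  have Qci : (Q *m col ord0 A)%R (rshift 1 i : 'I_N.+1) 0%R = 0%R.
    by rewrite Qc !mxE mulr0.
  rewrite /B !mxE -[RHS]Qci [RHS]mxE.
  apply: eq_bigr => k _; rewrite mxE; congr (_ * A _ _)%R; exact: val_inj.
have := BB; rewrite -[B]submxK dlB tr_block_mx mulmx_block !trmx0 !mul0mx !mulmx0.
rewrite !addr0 scalar_mx_block => /eq_block_mx [].
set a := ulsubmx B; set u := ursubmx B; set D := drsubmx B.
move=> aa au _ uD.
have aE : a = (a 0 0)%:M%R by exact: mx11_scalar.
have a2 : (a 0 0 ^+ 2 = 1)%R.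
  rewrite aE tr_scalar_mx -scalar_mxM in aa; move/matrixP : aa => /(_ 0%R 0%R).
  by rewrite [LHS]mxE [RHS]mxE eqxx !mulr1n expr2.
have a0 : (a 0 0 != 0)%R by rewrite -sqrf_eq0 a2 oner_eq0.
have u0 : u = 0%R.
  rewrite aE tr_scalar_mx mul_scalar_mx in au; move: au => /(congr1 ( *:%R (a 0 0)^-1)%R).
  by rewrite scalerA mulVf// scale1r scaler0.
move: uD; rewrite u0 mulmx0 add0r => DD.
have mfA := measurableT_comp mf (measurable_mulmx_tuple A).
rewrite -(iQ _ mfA (fun t => f0 _)).
have mfB := measurableT_comp mf (measurable_mulmx_tuple B).
transitivity (\int[gaussian_tuple N.+1]_t f (mulmx_tuple B t)).
  by apply: eq_integral => t _ /=; rewrite -mulmx_tupleM.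
rewrite (integral_gaussian_tupleS mfB (fun t => f0 _)) (integral_gaussian_tupleS mf f0).
have -> : B = block_mx (a 0 0)%:M%R 0%R 0%R D by rewrite -aE -u0 -dlB submxK.
pose g (x : mR) := \int[gaussian_tuple n]_t f (cons_pair (x, t)).
have g0 x : 0 <= g x by exact: integral_ge0.
have mg : measurable_fun setT g by exact: measurable_integral_cons.
transitivity (\int[nu]_x g (x * a 0 0)%R).
  apply: eq_integral => x _.
  have mfx : measurable_fun setT (fun t => f (cons_pair ((x * a 0 0)%R : mR, t))).
    exact: (measurableT_comp mf (measurableT_comp (@measurable_cons_pair R _) (measurable_pair1 _))).
  rewrite /g -(IH _ _ _ DD mfx (fun t => f0 _)); apply: eq_integral => t _ /=.
  by rewrite mulmx_tuple_block.
(* The corner entry is 1 or -1; the sign is absorbed by the symmetry of the one-dimensional law. *)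
move/eqP : a2; rewrite sqrf_eq1 => /orP[] /eqP ->.
  by apply: eq_integral => x _; rewrite mulr1.
rewrite -[RHS](integral_normalN mg g0).
by apply: eq_integral => x _; rewrite mulrN1.
Qed.

End gaussian_tuple_invariance.

(** * Finite rank operators and the gamma norm *)

Section measurable_coordinates.
Context {R : realType} {d : measure_display} {T : measurableType d} {n : nat}.
Variable X : 'I_n -> T -> R.
Hypothesis mX : forall i, measurable_fun setT (X i).

(** An open set is a countable union of boxes with rational centre and radius $1/(m+1)$, and the
    preimage of a box is a finite intersection of measurable sets. *)
Lemma measurable_open_coordinates (U : set 'rV[R]_n) : open U ->
  measurable [set w | U (\row_i X i w)].
Proof.
move=> oU.
pose box (z : {ffun 'I_n -> rat} * nat) : set 'rV[R]_n :=
  [set v | forall i, `|v 0 i - ratr (z.1 i)| < z.2.+1%:R^-1].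
have -> : [set w | U (\row_i X i w)] =
    \bigcup_z (if `[< box z `<=` U >] then
      [set w | box z (\row_i X i w)] else set0).
  apply/seteqP; split => w /=; last first.
    by move=> [z _]; case: asboolP => // + ?; exact.
  move=> Uw.
  have /nbhs_ballP[e /= e0 eU] : nbhs (\row_i X i w) U by exact: open_nbhs_nbhs.
  (* A box of radius below [e / 2] that contains the point lies in the ball of radius [e] around
     it. *)
  have [m me] : exists m : nat, m.+1%:R^-1 < e / 2.
    have e20 : 0 < e / 2 by rewrite divr_gt0.
    have [N _ /(_ N (leqnn N)) Ne] := near_infty_natSinv_lt (PosNum e20).
    by exists N; exact: Ne.
  have qE i : exists q : rat, `|X i w - ratr q| < m.+1%:R^-1.
    have m0 : 0 < m.+1%:R^-1 :> R by rewrite invr_gt0.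
    have mX0 : X i w - m.+1%:R^-1 < X i w by rewrite ltrBlDr ltrDl.
    have [q] := rat_in_itvoo mX0; rewrite in_itv/= => /andP[Xq qX].
    exists q; rewrite ltr_norml; apply/andP; split.
      by rewrite (lt_trans (y := 0)) ?oppr_lt0 ?subr_gt0.
    by rewrite ltrBlDr -ltrBlDl.
  have [q qP] := choice qE.
  exists ([ffun i => q i], m) => //.
  have -> : `[< box ([ffun i => q i], m) `<=` U >].
    apply/asboolP => v vbox; apply: eU; split=> // i j; rewrite !ord1 mxE.
    have := vbox j; have := qP j; rewrite ffunE /ball/= => Xq vq.
    rewrite -(subrKA (ratr (q j))) (le_lt_trans (ler_normD _ _))//.
    rewrite (splitr e) ltrD ?(lt_trans Xq)// distrC.
    exact: lt_trans vq me.
  by move=> i; rewrite mxE ffunE.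
apply: countable_bigcupT_measurable => // z; case: ifP => // _.
rewrite (_ : [set w | _] = \bigcap_(i in [set: 'I_n])
    ((fun w => `|X i w - ratr (z.1 i)|) @^-1` `]-oo, z.2.+1%:R^-1[)); last first.
  apply/seteqP; split => w /= H i; first by move=> _ /=; rewrite in_itv/=; have := H i; rewrite mxE.
  by rewrite mxE; have := H i I; rewrite /= in_itv.
apply: fin_bigcap_measurable; first exact: finite_finset.
move=> i _; rewrite -[X in measurable X]setTI.
have mf : measurable_fun setT (fun w => `|X i w - ratr (z.1 i)|).
  by apply: measurableT_comp => //; apply: measurable_funB.
exact: mf.
Qed.

Lemma measurable_continuous_coordinates (f : 'rV[R]_n -> R) :
  continuous f -> measurable_fun setT (fun w => f (\row_i X i w)).
Proof.
move=> cf; apply: (measurability _ (RGenOpens.measurableE R)) => /= _ [_ [a [b ->]] <-].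
rewrite setTI; apply: (@measurable_open_coordinates (f @^-1` `]a, b[)).
by apply: open_comp => //; exact: interval_open.
Qed.

(** The norm is a continuous function of the scalar coefficients, so no sigma-algebra on [E]
    enters. *)
Lemma measurable_norm_lincomb (E : normedModType R) (x : 'I_n -> E) (y : E) :
  measurable_fun setT (fun w => `|\sum_(i < n) X i w *: x i + y|).
Proof.
rewrite (_ : (fun w => _) =
    fun w => (fun v : 'rV[R]_n => `|\sum_(i < n) v 0 i *: x i + y|) (\row_i X i w)); last first.
  by apply/funext => w /=; congr (`|_ + _|); apply: eq_bigr => i _; rewrite mxE.
apply: (@measurable_continuous_coordinates
  (fun v : 'rV[R]_n => `|\sum_(i < n) v 0 i *: x i + y|)) => v.
have cS : continuous (fun v : 'rV[R]_n => \sum_(i < n) v 0 i *: x i + y).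
  have cZ i : continuous (fun v : 'rV[R]_n => v 0 i *: x i).
    move=> u; exact: (cvgZr_tmp (s := fun v : 'rV[R]_n => v 0 i) (@coord_continuous R 1 n 0 i u)).
  have cS0 : continuous (fun v : 'rV[R]_n => \sum_(i < n) v 0 i *: x i).
    by apply: continuous_big => [|i _]; [exact: add_continuous|exact: cZ].
  by move=> u; exact: (cvgD (cS0 u) (cvg_cst y)).
exact: (cvg_norm (cS v)).
Qed.

End measurable_coordinates.

(** * Monotonicity and homogeneity of $L^p$ norms *)

Section Lnorm_lemmas.
Context {d : measure_display} {T : measurableType d} {R : realType}.
Variable mu : {measure set T -> \bar R}.
Local Open Scope ereal_scope.

Lemma le_Lnorm (p : R) (f g : T -> \bar R) : (0 < p)%R ->
  measurable_fun setT f -> measurable_fun setT g ->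
  (forall x, 0 <= f x) -> (forall x, f x <= g x) ->
  Lnorm mu p%:E f <= Lnorm mu p%:E g.
Proof.
move=> p0 mf mg f0 fg; rewrite unlock /=.
have mp (h : T -> \bar R) : measurable_fun setT h ->
    measurable_fun setT (fun x => `|h x| `^ p).
  by move=> mh; apply: (measurableT_comp (measurable_poweR p)); exact: measurableT_comp.
apply: gt0_ler_poweR.
- by rewrite invr_ge0 ltW.
- by rewrite in_itv/= leey andbT integral_ge0// => x _; exact: poweR_ge0.
- by rewrite in_itv/= leey andbT integral_ge0// => x _; exact: poweR_ge0.
apply: ge0_le_integral => //; [by move=> x _; exact: poweR_ge0|exact: mp| |].
  exact: mp.
move=> x _; apply: gt0_ler_poweR; first exact: ltW.
- by rewrite in_itv/= leey andbT.
- by rewrite in_itv/= leey andbT.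
- by rewrite !gee0_abs// (le_trans (f0 x)).
Qed.

Lemma LnormZ (p c : R) (f : T -> \bar R) : (0 < p)%R -> (0 <= c)%R ->
  measurable_fun setT f -> (forall x, 0 <= f x) ->
  Lnorm mu p%:E (fun x => c%:E * f x) = c%:E * Lnorm mu p%:E f.
Proof.
move=> p0 c0 mf f0; rewrite unlock /=.
under eq_integral => x _.
  rewrite gee0_abs ?mule_ge0// poweRM// poweR_EFin.
  rewrite -[X in X `^ _](gee0_abs (f0 x)).
  over.
rewrite /= ge0_integralZl_EFin ?powR_ge0//; last 2 first.
- by move=> x _; exact: poweR_ge0.
- by apply: (measurableT_comp (measurable_poweR p)); exact: measurableT_comp.
rewrite poweRM ?lee_fin ?powR_ge0//; last by apply: integral_ge0 => x _; exact: poweR_ge0.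
by rewrite poweR_EFin -powRrM mulfV ?gt_eqF// powRr1.
Qed.

End Lnorm_lemmas.

(** * Inner products and Gram-Schmidt *)

Section orthonormal.
Context {R : realType} {H : normedModType R} (ip : {dot H for idfun}).

Lemma dotC x y : ip x y = ip y x.
Proof. by rewrite hermitian_subproof expr0 mul1r. Qed.

Lemma dotZl a x y : ip (a *: x) y = a * ip x y.
Proof. exact: linearZl_LR. Qed.

Lemma dotZr a x y : ip x (a *: y) = a * ip x y.
Proof. exact: linearZr_LR. Qed.

Lemma dotDr x y z : ip x (y + z) = ip x y + ip x z.
Proof. exact: linearDr. Qed.

Lemma dotBr x y z : ip x (y - z) = ip x y - ip x z.
Proof. exact: linearBr. Qed.

Lemma dot_sumr n x (y : 'I_n -> H) : ip x (\sum_(i < n) y i) = \sum_(i < n) ip x (y i).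
Proof. exact: linear_sumr. Qed.

Lemma dot_suml n x (y : 'I_n -> H) : ip (\sum_(i < n) y i) x = \sum_(i < n) ip (y i) x.
Proof. exact: linear_sumlz. Qed.

Lemma dot0l x : ip 0 x = 0.
Proof. exact: linear0l. Qed.

(** Membership in the span of an orthonormal [e], with the Fourier coefficients as explicit
    witnesses. *)
Definition spanned_by n (e : 'I_n -> H) (h : H) : Prop :=
  h = \sum_(i < n) ip (e i) h *: e i.

Lemma gram_schmidt (s : seq H) : exists n (e : 'I_n -> H),
  orthonormal_family ip e /\ forall h, h \in s -> spanned_by e h.
Proof.
elim: s => [|v s [n [e [eo es]]]].
  by exists 0, (fun=> 0); split=> // -[].
pose u := v - \sum_(i < n) ip (e i) v *: e i.
have eu j : ip (e j) u = 0.
  rewrite dotBr dot_sumr (bigD1 j)//= dotZr eo eqxx mulr1.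
  rewrite big1 ?addr0 ?subrr// => i ij.
  by rewrite dotZr eo eq_sym (negbTE ij) mulr0.
have [u0|u0] := eqVneq u 0.
  exists n, e; split=> // h; rewrite in_cons => /orP[/eqP ->|/es//].
  by apply/eqP; rewrite -subr_eq0; apply/eqP.
have uu : 0 < ip u u by exact: neq0_dnorm_gt0.
pose c := (Num.sqrt (ip u u))^-1.
have c2 : c * c * ip u u = 1.
  by rewrite -expr2 exprVn sqr_sqrtr ?ltW// mulVf// gt_eqF.
pose e' (i : 'I_n.+1) := oapp e (c *: u) (unlift ord0 i).
have e'0 : e' ord0 = c *: u by rewrite /e' unlift_none.
have e'S i : e' (lift ord0 i) = e i by rewrite /e' liftK.
exists n.+1, e'; split.
  move=> i j; case: (unliftP ord0 i) => [i'|] ->; case: (unliftP ord0 j) => [j'|] ->;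
    rewrite ?e'0 ?e'S ?(inj_eq (lift_inj (h := ord0))) ?dotZr ?dotZl ?eu ?mulr0//.
  - by rewrite dotC eu mulr0.
  - by rewrite eqxx mulrA.
move=> h; rewrite /spanned_by big_ord_recl e'0 dotZl in_cons.
under eq_bigr do rewrite e'S.
move=> /orP[/eqP ->|/es hE].
  (* [v - u] lies in the span of [e], which is orthogonal to [u]. *)
  have -> : ip u v = ip u u.
    have -> : ip u v = ip u (u + \sum_(i < n) ip (e i) v *: e i) by rewrite subrK.
    rewrite dotDr dot_sumr big1 ?addr0// => i _.
    by rewrite dotZr [ip u _]dotC eu mulr0.
  by rewrite scalerA mulrAC c2 scale1r subrK.
rewrite [in ip u h]hE dot_sumr big1 ?mulr0 ?scale0r ?add0r// => i _.
by rewrite dotZr [ip u _]dotC eu mulr0.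
Qed.

End orthonormal.

(** * Finite rank operators: independence of the orthonormal family *)

Section finite_rank_operators.
Context {R : realType} {H : normedModType R} (ip : {dot H for idfun}).
Context {E : normedModType R}.
Implicit Types (S T : H -> E).

(** For orthonormal [e] this says that [T] factors through the orthogonal projection onto the span
    of [e]. *)
Definition expands_along n (e : 'I_n -> H) T : Prop :=
  T = \sum_(i < n) rank_one ip (e i) (T (e i)).

(** The columns of the matrix are the coordinates of the orthonormal [h j] in the orthonormal family
    [e], so it is an isometry; it carries the coefficients [x] to the values [T (e i)]. *)
Lemma finite_rank_expansion n (h : 'I_n -> H) (x : 'I_n -> E) T m (e : 'I_m -> H) :
  finite_rank_rep ip h x T -> orthonormal_family ip e ->
  (forall j, spanned_by ip e (h j)) ->
  [/\ expands_along e T,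
      (\matrix_(i, j) ip (e i) (h j))^T *m (\matrix_(i, j) ip (e i) (h j)) = 1%:M
    & forall i, T (e i) = \sum_(j < n) ip (e i) (h j) *: x j].
Proof.
move=> [ho TE] eo he.
have TeE i : T (e i) = \sum_(j < n) ip (e i) (h j) *: x j.
  by rewrite TE fct_sumE; apply: eq_bigr => j _; rewrite /rank_one dotC.
split => //.
  apply/funext => k; rewrite {1}TE !fct_sumE.
  under [RHS]eq_bigr => i _ do rewrite /rank_one TeE scaler_sumr.
  rewrite exchange_big/=; apply: eq_bigr => j _.
  rewrite /rank_one {1}(he j) dot_suml scaler_suml.
  by apply: eq_bigr => i _; rewrite dotZl scalerA mulrC.
apply/matrixP => j k; rewrite !mxE -(ho j k) [in RHS](he j) dot_suml.
by apply: eq_bigr => i _; rewrite !mxE dotZl.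
Qed.

Lemma gaussian_normE n (x : 'I_n -> E) :
  gaussian_norm x = ((\int[gaussian_tuple n]_t
    (`|(`| \sum_(j < n) (tnth t j : R) *: x j |)%:E| `^ 2)) `^ 2^-1)%E.
Proof. by rewrite /gaussian_norm unlock. Qed.

Lemma measurable_gaussian_sum n (x : 'I_n -> E) :
  measurable_fun setT (fun t : n.-tuple (measurableTypeR R) =>
    (`| \sum_(j < n) (tnth t j : R) *: x j |)%:E).
Proof.
apply/measurable_EFinP.
have := @measurable_norm_lincomb R _ _ n
  (fun i (t : n.-tuple (measurableTypeR R)) => tnth t i)
  (fun i => measurable_tnth i) E x 0.
by under eq_fun do rewrite addr0.
Qed.

(** Exchanging the sums turns the Gaussian sum on the left into the sum of the [x j] weighted by the
    row vector $tA$, which is again standard Gaussian. *)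
Lemma gaussian_norm_isometry m n (A : 'M[R]_(m, n)) (x : 'I_n -> E) :
  A^T *m A = 1%:M ->
  gaussian_norm (fun i => \sum_(j < n) A i j *: x j) = gaussian_norm x.
Proof.
move=> AA; rewrite !gaussian_normE; congr (_ `^ _)%E.
have mf : measurable_fun setT (fun t : n.-tuple (measurableTypeR R) =>
    (`|(`| \sum_(j < n) (tnth t j : R) *: x j |)%:E| `^ 2)%E).
  apply: (measurableT_comp (measurable_poweR 2)).
  apply: measurableT_comp => //; exact: measurable_gaussian_sum.
rewrite -(integral_gaussian_isometry AA mf); last by move=> t; exact: poweR_ge0.
apply: eq_integral => t _; congr (`|(`|_|)%:E| `^ _)%E.
under eq_bigr do rewrite scaler_sumr.
rewrite exchange_big/=; apply: eq_bigr => j _.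
rewrite tnth_mktuple scaler_suml; apply: eq_bigr => i _.
by rewrite scalerA.
Qed.

Lemma gaussian_norm_expansion n (h : 'I_n -> H) (x : 'I_n -> E) T m (e : 'I_m -> H) :
  finite_rank_rep ip h x T -> orthonormal_family ip e ->
  (forall j, spanned_by ip e (h j)) ->
  gaussian_norm (fun i => T (e i)) = gaussian_norm x.
Proof.
move=> Thx eo he; have [_ AA TeE] := finite_rank_expansion Thx eo he.
rewrite -(gaussian_norm_isometry x AA); congr gaussian_norm.
by apply/funext => i; rewrite TeE; apply: eq_bigr => j _; rewrite mxE.
Qed.

Lemma spanning_family n (h : 'I_n -> H) k (h' : 'I_k -> H) : exists m (e : 'I_m -> H),
  [/\ orthonormal_family ip e, forall j, spanned_by ip e (h j)
    & forall j, spanned_by ip e (h' j)].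
Proof.
have [m [e [eo es]]] := gram_schmidt ip (codom h ++ codom h').
exists m, e; split => // j; apply: es; rewrite mem_cat codom_f ?orbT//.
Qed.

(** Any two representations are compared through an orthonormal family spanning both, so the infimum
    is over a singleton. *)
Lemma finite_rank_normE n (h : 'I_n -> H) (x : 'I_n -> E) T :
  finite_rank_rep ip h x T -> finite_rank_norm ip T = gaussian_norm x.
Proof.
move=> Thx; rewrite /finite_rank_norm (_ : [set v | _] = [set gaussian_norm x]) ?ereal_inf1//.
apply/seteqP; split => [v [k [h' [x' [Thx' ->]]]]|_ ->]; last by exists n, h, x.
have [m [e [eo he he']]] := spanning_family h h'.
by rewrite /= -(gaussian_norm_expansion Thx eo he) (gaussian_norm_expansion Thx' eo he').
Qed.

Lemma common_expansion S T : finite_rank ip S -> finite_rank ip T ->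
  exists m (e : 'I_m -> H),
    [/\ orthonormal_family ip e, expands_along e S & expands_along e T].
Proof.
move=> [n [h [x Shx]]] [k [h' [x' Thx']]].
have [m [e [eo he he']]] := spanning_family h h'.
exists m, e; split => //.
  by have [] := finite_rank_expansion Shx eo he.
by have [] := finite_rank_expansion Thx' eo he'.
Qed.

Lemma finite_rank_norm_expands n (e : 'I_n -> H) T :
  orthonormal_family ip e -> expands_along e T ->
  finite_rank_norm ip T = gaussian_norm (fun i => T (e i)).
Proof. by move=> eo eT; apply: (finite_rank_normE (h := e)). Qed.

Lemma expands_alongD n (e : 'I_n -> H) S T :
  expands_along e S -> expands_along e T -> expands_along e (S + T).
Proof.
move=> eS eT; apply/funext => k; rewrite fct_sumE -[LHS]/(S k + T k).
have -> : S k = \sum_(i < n) rank_one ip (e i) (S (e i)) k by rewrite {1}eS fct_sumE.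
have -> : T k = \sum_(i < n) rank_one ip (e i) (T (e i)) k by rewrite {1}eT fct_sumE.
by rewrite -big_split/=; apply: eq_bigr => i _; rewrite /rank_one -scalerDr.
Qed.

Lemma finite_rankD S T : finite_rank ip S -> finite_rank ip T -> finite_rank ip (S + T).
Proof.
move=> fS fT; have [n [e [eo eS eT]]] := common_expansion fS fT.
by exists n, e, (fun i => (S + T) (e i)); split=> //; exact: expands_alongD.
Qed.

Lemma finite_rank0 : finite_rank ip (0 : H -> E).
Proof. by exists 0, (fun=> 0), (fun=> 0); split=> [[]//|]; rewrite big_ord0. Qed.

Lemma finite_rank_sum I (r : seq I) (P : pred I) (F : I -> H -> E) :
  (forall i, P i -> finite_rank ip (F i)) -> finite_rank ip (\sum_(i <- r | P i) F i).
Proof.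
by move=> fF; elim/big_ind : _ => //; [exact: finite_rank0|exact: finite_rankD].
Qed.

Lemma finite_rank_rank_one (h : H) (x : E) : finite_rank ip (rank_one ip h x).
Proof.
have [h0|h0] := eqVneq h 0.
  rewrite (_ : rank_one _ _ _ = 0); first exact: finite_rank0.
  by apply/funext => k; rewrite /rank_one h0 dot0l scale0r.
have hh : 0 < ip h h by exact: neq0_dnorm_gt0.
pose c := Num.sqrt (ip h h).
have c0 : c != 0 by rewrite gt_eqF// sqrtr_gt0.
have c2 : c * c = ip h h by rewrite -expr2 sqr_sqrtr// ltW.
(* The vector [h] has to be normalized; its length moves to [x]. *)
exists 1%N, (fun=> c^-1 *: h), (fun=> c *: x); split.
  move=> i j; rewrite !ord1 eqxx dotZl dotZr -c2.
  by rewrite mulKf// mulVf.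
apply/funext => k; rewrite big_ord1 /rank_one dotZl scalerA mulrAC mulVf// mul1r//.
Qed.

Lemma finite_rank_norm_ge0 T : (0 <= finite_rank_norm ip T)%E.
Proof.
by apply/ereal_infP => _ [n [h [x [_ ->]]]]; exact: Lnorm_ge0.
Qed.

Lemma finite_rank_norm0 : finite_rank_norm ip (0 : H -> E) = 0%E.
Proof.
rewrite (@finite_rank_normE 0 (fun=> 0) (fun=> 0)); last first.
  by split=> [[]//|]; rewrite big_ord0.
rewrite /gaussian_norm (_ : (fun _ => _) = cst 0%E) ?Lnorm0//.
by apply/funext => t; rewrite big_ord0 normr0.
Qed.

(** Along a common family the three norms are $L^2$ norms on the same Gaussian space, and
    Minkowski's inequality applies. *)
Lemma finite_rank_normD S T : finite_rank ip S -> finite_rank ip T ->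
  (finite_rank_norm ip (S + T)%R <= finite_rank_norm ip S + finite_rank_norm ip T)%E.
Proof.
move=> fS fT; have [n [e [eo eS eT]]] := common_expansion fS fT.
rewrite (finite_rank_norm_expands eo eS) (finite_rank_norm_expands eo eT).
rewrite (finite_rank_norm_expands eo (expands_alongD eS eT)).
pose f U (t : n.-tuple (measurableTypeR R)) := `|\sum_(j < n) (tnth t j : R) *: (U : H -> E) (e j)|.
have mf U : measurable_fun setT (f U).
  by apply: (measurable_EFinP setT (f U)).1; exact: (measurable_gaussian_sum (fun j => U (e j))).
apply: le_trans (minkowski_EFin (gaussian_tuple n) (mf S) (mf T) _); last by rewrite ler1n.
apply: le_Lnorm => //.
- exact: measurable_gaussian_sum.
- by apply/measurable_EFinP; exact: measurable_funD.
- move=> t; rewrite lee_fin /f /=.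
  rewrite (_ : \sum_(j < n) _ = \sum_(j < n) (tnth t j : R) *: S (e j) +
     \sum_(j < n) (tnth t j : R) *: T (e j)) ?ler_normD//.
  by rewrite -big_split/=; apply: eq_bigr => j _; rewrite -scalerDr.
Qed.

Let normal_second_moment (c : R) : 0 <= c ->
  (\int[normal_prob (0 : R) 1]_y (`|y| ^+ 2 * c)%:E < +oo)%E.
Proof.
move=> c0.
have ms : measurable_fun setT (fun y : measurableTypeR R => (`|y| ^+ 2 * c)%:E).
  apply/measurable_EFinP; apply: measurable_funM => //.
  by apply: measurable_funX; exact: (measurableT_comp (@normr_measurable R setT)).
rewrite integral_normal_prob//; last by move=> y; rewrite lee_fin mulr_ge0// exprn_ge0.
(* y ^ 2 exp(- y ^ 2 / 2) <= 4 exp(- y ^ 2 / 4), and the right-hand side is *)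
(* proportional to the density of N(0, 2).                                   *)
pose s : R := Num.sqrt 2.
have s2 : s ^+ 2 = 2 by rewrite sqr_sqrtr.
have s0 : s != 0 by rewrite -sqrf_eq0 s2.
pose K := 4 * c * normal_peak 1 / normal_peak s.
have K0 : 0 <= K by rewrite !mulr_ge0 ?invr_ge0 ?normal_peak_ge0.
have mpdf (u : R) : measurable_fun setT (fun y : measurableTypeR R => (normal_pdf 0 u y)%:E).
  by apply/measurable_EFinP; exact: measurable_normal_pdf.
apply: (@le_lt_trans _ _ (\int[lebesgue_measure]_y (K%:E * (normal_pdf 0 s y)%:E)))%E; last first.
  rewrite ge0_integralZl_EFin// ?integral_normal_pdf ?mule1 ?ltry//.
  by move=> y _; rewrite lee_fin normal_pdf_ge0.
apply: ge0_le_integral => //.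
- by move=> y _; rewrite mule_ge0// lee_fin ?normal_pdf_ge0// mulr_ge0// exprn_ge0.
- exact: emeasurable_funM.
- exact: emeasurable_funM.
move=> y _; rewrite -!EFinM lee_fin !normal_pdfE ?oner_neq0// /normal_fun s2 !subr0.
rewrite real_normK ?num_real//.
have b0 : normal_peak s != 0 by rewrite gt_eqF ?normal_peak_gt0.
have -> u : K * (normal_peak s * u) = (c * normal_peak 1) * (4 * u).
  by rewrite /K; field.
have -> u : y ^+ 2 * c * (normal_peak 1 * u) = (c * normal_peak 1) * (y ^+ 2 * u) by ring.
rewrite ler_wpM2l ?mulr_ge0 ?normal_peak_ge0//.
rewrite (_ : - y ^+ 2 / (1 ^+ 2 *+ 2) = - (y ^+ 2 / 4) + - y ^+ 2 / (2 *+ 2)); last by field.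
rewrite expRD mulrA ler_wpM2r ?expR_ge0// expRN ler_pdivrMr ?expR_gt0//.
rewrite -ler_pdivrMl// mulrC (le_trans _ (expR_ge1Dx _))//.
by rewrite lerDr.
Qed.

(** The triangle inequality reduces this to one term with a unit vector, where it is the finiteness
    of the Gaussian second moment. *)
Lemma finite_rank_norm_lty T : finite_rank ip T -> (finite_rank_norm ip T < +oo)%E.
Proof.
have rank_one_lty h (x : E) : ip h h = 1 ->
    (finite_rank_norm ip (rank_one ip h x) < +oo)%E.
  move=> h1; rewrite (@finite_rank_normE 1 (fun=> h) (fun=> x)); last first.
    by split; [move=> i j; rewrite !ord1 eqxx|rewrite big_ord1].
  rewrite gaussian_normE poweR_lty//.
  have mf : measurable_fun setT (fun t : 1.-tuple (measurableTypeR R) =>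
      (`|(`| \sum_(j < 1) (tnth t j : R) *: x |)%:E| `^ 2)%E).
    apply: (measurableT_comp (measurable_poweR 2)).
    apply: measurableT_comp => //; exact: (measurable_gaussian_sum (fun=> x)).
  rewrite (integral_gaussian_tupleS mf (fun t => poweR_ge0 _ _)).
  rewrite (eq_integral (fun y : measurableTypeR R => (`|y : R| ^+ 2 * `|x| ^+ 2)%:E)).
    by apply: normal_second_moment; rewrite exprn_ge0.
  move=> y _; rewrite integral_gaussian_tuple0 big_ord1 /cons_pair/=.
  rewrite (_ : tnth _ _ = y); last by rewrite (ord1 ord0).
  by rewrite normr_id normrZ powR_mulrn// exprMn.
move=> [n [h [x [ho ->]]]].
suff : finite_rank ip (\sum_(j < n) rank_one ip (h j) (x j)) /\
  (finite_rank_norm ip (\sum_(j < n) rank_one ip (h j) (x j))%R < +oo)%E by case.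
elim/big_ind : _ => [|S S' [fS nS] [fT nT]|j _].
- by split; [exact: finite_rank0|rewrite finite_rank_norm0].
- split; first exact: finite_rankD.
  by apply: le_lt_trans (finite_rank_normD fS fT) _; rewrite lte_add_pinfty.
- split; first exact: finite_rank_rank_one.
  by apply: rank_one_lty; rewrite ho eqxx.
Qed.

End finite_rank_operators.

(** * Composition of finite rank operators with a bounded operator *)

Section composition.
Context {R : realType} {H : normedModType R} (ip : {dot H for idfun}).
Context {E E' : normedModType R} (L : E -> E') (c : R).
Hypothesis linL : linear L.
Hypothesis c0 : 0 <= c.
Hypothesis bndL : forall x, `|L x| <= c * `|x|.

Lemma finite_rank_rep_comp n (h : 'I_n -> H) (x : 'I_n -> E) (T : H -> E) :
  finite_rank_rep ip h x T -> finite_rank_rep ip h (L \o x) (L \o T).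
Proof.
move=> [ho ->]; split => //; apply/funext => k /=; rewrite !fct_sumE.
pose LL := GRing.isLinear.Build R E E' *:%R L linL.
pose L' : {linear E -> E'} := HB.pack L LL.
rewrite -[L]/(L' : E -> E') linear_sum; apply: eq_bigr => i _.
by rewrite /rank_one linearZ.
Qed.

Lemma finite_rank_comp (T : H -> E) : finite_rank ip T -> finite_rank ip (L \o T).
Proof.
by move=> [n [h [x Thx]]]; exists n, h, (L \o x); exact: finite_rank_rep_comp.
Qed.

(** The orthonormal family is unchanged, and [L] comes out of the Gaussian sum, so the bound on [L]
    holds pointwise under the integral. *)
Lemma finite_rank_norm_comp (T : H -> E) : finite_rank ip T ->
  (finite_rank_norm ip (L \o T) <= c%:E * finite_rank_norm ip T)%E.
Proof.
move=> [n [h [x Thx]]]; rewrite (finite_rank_normE Thx).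
rewrite (finite_rank_normE (finite_rank_rep_comp Thx)).
rewrite /gaussian_norm -LnormZ//; last exact: measurable_gaussian_sum.
apply: le_Lnorm => //.
- exact: (measurable_gaussian_sum (L \o x)).
- apply: emeasurable_funM => //; exact: measurable_gaussian_sum.
- move=> t; rewrite -EFinM lee_fin (le_trans _ (bndL _))//.
  pose LL := GRing.isLinear.Build R E E' *:%R L linL.
  pose L' : {linear E -> E'} := HB.pack L LL.
  rewrite -[L]/(L' : E -> E') linear_sum.
  by under [in leRHS]eq_bigr do rewrite linearZ.
Qed.

End composition.

(** * From finite rank operators to the gamma norm *)

Section gamma_norm_theory.
Context {R : realType} {H : normedModType R} (ip : {dot H for idfun}).
Context {E : normedModType R}.
Implicit Types (S T : H -> E).

Lemma finite_rankZ (a : R) T : finite_rank ip T -> finite_rank ip (a *: T).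
Proof.
move=> [n [h [x [ho ->]]]]; rewrite scaler_sumr; apply: finite_rank_sum => j _.
rewrite (_ : _ *: _ = rank_one ip (h j) (a *: x j)); first exact: finite_rank_rank_one.
by apply/funext => k; rewrite /rank_one fctE !scalerA mulrC.
Qed.

Lemma finite_rankN T : finite_rank ip T -> finite_rank ip (- T).
Proof. by rewrite -scaleN1r; exact: finite_rankZ. Qed.

Lemma finite_rankB S T : finite_rank ip S -> finite_rank ip T -> finite_rank ip (S - T).
Proof. by move=> fS fT; apply: finite_rankD => //; exact: finite_rankN. Qed.

(** Makes the norms of a Cauchy sequence of operators a Cauchy sequence of reals. The symmetry of
    the norm is obtained from composition with [-%R]. *)
Lemma finite_rank_normB_le S T : finite_rank ip S -> finite_rank ip T ->
  (`|fine (finite_rank_norm ip S) - fine (finite_rank_norm ip T)|%:E <=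
   finite_rank_norm ip (S - T)%R)%E.
Proof.
move=> fS fT.
have fin (U : H -> E) : finite_rank ip U -> finite_rank_norm ip U = (fine (finite_rank_norm ip U))%:E.
  by move=> fU; rewrite fineK// ge0_fin_numE ?finite_rank_norm_ge0 ?finite_rank_norm_lty.
have ST : (finite_rank_norm ip S <= finite_rank_norm ip (S - T)%R + finite_rank_norm ip T)%E.
  rewrite -{1}(subrK T S); apply: finite_rank_normD => //; exact: finite_rankB.
have NE : finite_rank_norm ip (T - S)%R = finite_rank_norm ip (S - T)%R.
  have le (U : H -> E) : finite_rank ip U -> (finite_rank_norm ip (- U)%R <= finite_rank_norm ip U)%E.
    have linN : linear (-%R : E -> E) by move=> a u v; rewrite opprD scalerN.
    have bN (x : E) : `|- x| <= 1 * `|x| by rewrite normrN mul1r.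
    by move=> fU; have := finite_rank_norm_comp linN ler01 bN fU; rewrite mul1e.
  apply/eqP; rewrite eq_le; apply/andP; split.
    by rewrite -{1}(opprB S T); apply: le; exact: finite_rankB.
  by rewrite -{1}(opprB T S); apply: le; exact: finite_rankB.
have TS : (finite_rank_norm ip T <= finite_rank_norm ip (S - T)%R + finite_rank_norm ip S)%E.
  rewrite -NE -{1}(subrK S T); apply: finite_rank_normD => //; exact: finite_rankB.
move: ST TS; rewrite (fin _ fS) (fin _ fT) (fin _ (finite_rankB fS fT))/= -!EFinD !lee_fin => ST TS.
by rewrite ler_norml; apply/andP; split; lra.
Qed.

(** Guarantees that every approximating sequence contributes a finite value to the infimum defining
    [gamma_norm]. *)
Lemma gamma_approx_cvg (T_ : nat -> H -> E) T : gamma_approx ip T_ T ->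
  exists l : R, (finite_rank_norm ip (T_ k) @[k --> \oo] --> l%:E)%E.
Proof.
move=> [fT cT _].
pose a k := fine (finite_rank_norm ip (T_ k)).
have aE k : finite_rank_norm ip (T_ k) = (a k)%:E.
  by rewrite fineK// ge0_fin_numE ?finite_rank_norm_ge0 ?finite_rank_norm_lty.
have : cvg (a @ \oo).
  apply: cauchy_cvg; apply: cauchy_exP => e e0.
  have [N NT] := cT e e0; exists (a N), N => // k /= Nk.
  rewrite /ball/= -lte_fin.
  exact: le_lt_trans (finite_rank_normB_le (fT N) (fT k)) (NT _ _ (leqnn N) Nk).
move=> ca; exists (lim (a @ \oo)).
rewrite (_ : (fun k => _) = EFin \o a); last by apply/funext => k; rewrite aE.
by apply: cvg_EFin => //; exact: nearW.
Qed.

Lemma gamma_norm_ge0 T : (0 <= gamma_norm ip T)%E.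
Proof.
apply/ereal_infP => l [T_ _ Tl]; apply: (cvge_ge _ Tl).
by apply: nearW => k; exact: finite_rank_norm_ge0.
Qed.

(** The constant sequence approximates [T]. This bound yields both finiteness on finite rank
    operators and the value at 0. *)
Lemma gamma_norm_le_finite_rank T : finite_rank ip T ->
  (gamma_norm ip T <= finite_rank_norm ip T)%E.
Proof.
move=> fT; apply/ge_ereal_inf; exists (finite_rank_norm ip T) => //.
exists (fun=> T); last exact: cvg_cst.
split => //.
- by move=> e e0; exists 0 => j k _ _; rewrite subrr finite_rank_norm0 lte_fin.
- by move=> h; exact: cvg_cst.
Qed.

Lemma gamma_norm_finite_rank_lty T : finite_rank ip T -> (gamma_norm ip T < +oo)%E.
Proof.
move=> fT; apply: le_lt_trans (gamma_norm_le_finite_rank fT) _.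
exact: finite_rank_norm_lty.
Qed.

Lemma gamma_norm0 : gamma_norm ip (0 : H -> E) = 0%E.
Proof.
apply/eqP; rewrite eq_le gamma_norm_ge0 andbT -(@finite_rank_norm0 R H ip E).
by apply: gamma_norm_le_finite_rank; exact: finite_rank0.
Qed.

(** Sums of nearly optimal approximating sequences approximate [S + T], and the finite rank triangle
    inequality passes to the limit; the loss [e / 2 + e / 2] is arbitrary. *)
Lemma gamma_normD S T :
  (gamma_norm ip (S + T)%R <= gamma_norm ip S + gamma_norm ip T)%E.
Proof.
have [->|Sfin] := eqVneq (gamma_norm ip S) +oo%E.
  by rewrite addye ?leey// gt_eqF// (lt_le_trans _ (gamma_norm_ge0 _)).
have [->|Tfin] := eqVneq (gamma_norm ip T) +oo%E.
  by rewrite addey ?leey// gt_eqF// (lt_le_trans _ (gamma_norm_ge0 _)).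
have {}Sfin : gamma_norm ip S \is a fin_num by rewrite ge0_fin_numE ?gamma_norm_ge0// ltey.
have {}Tfin : gamma_norm ip T \is a fin_num by rewrite ge0_fin_numE ?gamma_norm_ge0// ltey.
apply/lee_addgt0Pr => e e0.
have e20 : 0 < e / 2 by rewrite divr_gt0.
have [l [S_ aS lS] lle] := lb_ereal_inf_adherent e20 Sfin.
have [m [T_ aT mT] mle] := lb_ereal_inf_adherent e20 Tfin.
(* The limits [l] and [m] are a priori extended reals; uniqueness of limits shows that they are
   finite. *)
have [l' lS'] := gamma_approx_cvg aS.
have [m' mT'] := gamma_approx_cvg aT.
have ll' : l = l'%:E by exact: (cvg_unique _ lS lS').
have mm' : m = m'%:E by exact: (cvg_unique _ mT mT').
subst l m.
have [fS cS pS] := aS; have [fT cT pT] := aT.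
have aST : gamma_approx ip (fun k => S_ k + T_ k) (S + T).
  split => [k|e1 e10|h].
  - exact: finite_rankD.
  - have e120 : 0 < e1 / 2 by rewrite divr_gt0.
    have [N1 N1S] := cS _ e120; have [N2 N2T] := cT _ e120.
    exists (maxn N1 N2) => j k; rewrite !geq_max => /andP[j1 j2] /andP[k1 k2].
    rewrite opprD addrACA (splitr e1) EFinD.
    apply: le_lt_trans (finite_rank_normD (finite_rankB (fS j) (fS k)) (finite_rankB (fT j) (fT k))) _.
    by apply: lteD; [exact: N1S|exact: N2T].
  - by apply: cvgD; [exact: pS|exact: pT].
have [n nST] := gamma_approx_cvg aST.
apply: (@le_trans _ _ n%:E).
  by apply/ge_ereal_inf; exists n%:E => //; exists (fun k => S_ k + T_ k).
apply: (@le_trans _ _ (l'%:E + m'%:E)%E).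
  have lmD : (finite_rank_norm ip (S_ k) + finite_rank_norm ip (T_ k))%E @[k --> \oo] -->
      (l'%:E + m'%:E)%E by exact: cvgeD.
  rewrite -(cvg_lim _ nST)// -(cvg_lim _ lmD)//; apply: lee_lim.
  - by apply/cvg_ex; exists n%:E.
  - by apply/cvg_ex; exists (l'%:E + m'%:E)%E.
  - by apply: nearW => k; exact: finite_rank_normD.
rewrite (splitr e) EFinD addeACA; apply: leeD; exact: ltW.
Qed.

End gamma_norm_theory.

(** * The ideal property of the gamma norm *)

Section gamma_norm_composition.
Context {R : realType} {H : normedModType R} (ip : {dot H for idfun}).
Context {E E' : normedModType R} (L : E -> E') (c : R).
Hypothesis linL : linear L.
Hypothesis c0 : 0 <= c.
Hypothesis bndL : forall x, `|L x| <= c * `|x|.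

(** [L] maps an approximating sequence of [T] to one of [L \o T]: the Cauchy property comes from the
    finite rank bound, pointwise convergence from the continuity of [L]. No finiteness is assumed,
    since without approximating sequences the infimum is [+oo]. *)
Lemma gamma_norm_comp (T : H -> E) :
  (gamma_norm ip (L \o T) <= c%:E * gamma_norm ip T)%E.
Proof.
(* For [c = 0] the map [L] vanishes; otherwise [c] can be divided out of the infimum. *)
have [cc0|cn0] := eqVneq c 0.
  rewrite (_ : L \o T = 0) ?gamma_norm0 ?mule_ge0 ?gamma_norm_ge0//.
  apply/funext => h /=; apply/normr0_eq0/eqP.
  by rewrite eq_le normr_ge0 andbT (le_trans (bndL _))// cc0 mul0r.
have cp : 0 < c by rewrite lt0r cn0.
pose LL := GRing.isLinear.Build R E E' *:%R L linL.
pose L' : {linear E -> E'} := HB.pack L LL.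
have LB x y : L (x - y) = L x - L y by rewrite -[L]/(L' : E -> E') linearB.
have cL : continuous L.
  apply: (@linear_bounded_continuous _ _ _ L').1.
  apply/linear_boundedP; exists c; split; first exact: num_real.
  by move=> r /ltW cr x; rewrite (le_trans (bndL x))// ler_wpM2r.
rewrite -lee_pdivrMl//; apply/ereal_infP => l [T_ aT Tl].
rewrite lee_pdivrMl//; have [fT cT pT] := aT.
have aLT : gamma_approx ip (fun k => L \o T_ k) (L \o T).
  split => [k|e e0|h].
  - exact: finite_rank_comp.
  - have ec0 : 0 < e / c by rewrite divr_gt0.
    have [N NT] := cT _ ec0; exists N => j k Nj Nk.
    have -> : (L \o T_ j) - (L \o T_ k) = L \o (T_ j - T_ k).
      by apply/funext => h /=; rewrite -[RHS]/(L (T_ j h - T_ k h)) LB.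
    apply: le_lt_trans (finite_rank_norm_comp linL c0 bndL (finite_rankB (fT j) (fT k))) _.
    by rewrite -lte_pdivlMl// -EFinM mulrC; exact: NT.
  - by apply: continuous_cvg; [exact: cL|exact: pT].
have [n nLT] := gamma_approx_cvg aLT.
apply: (@le_trans _ _ n%:E).
  by apply/ge_ereal_inf; exists n%:E => //; exists (fun k => L \o T_ k).
have cTl : (c%:E * finite_rank_norm ip (T_ k))%E @[k --> \oo] --> (c%:E * l)%E.
  exact: cvgeZl.
rewrite -(cvg_lim _ nLT)// -(cvg_lim _ cTl)//; apply: lee_lim.
- by apply/cvg_ex; exists n%:E.
- by apply/cvg_ex; exists (c%:E * l)%E.
- by apply: nearW => k; exact: finite_rank_norm_comp.
Qed.

End gamma_norm_composition.

(** * Hoelder's inequality for vector-valued random variables *)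

Section generalized_hoelder.
Context {d : measure_display} {T : measurableType d} {R : realType}.
Variable mu : {measure set T -> \bar R}.

(** Hoelder's inequality for $f^r$ and $g^r$ with the conjugate exponents $p/r$ and $q/r$, followed
    by an $r$-th root. *)
Lemma hoelder_Lnorm (p q r : R) (f g : T -> R) :
  0 < p -> 0 < q -> 0 < r -> p^-1 + q^-1 = r^-1 ->
  measurable_fun setT f -> measurable_fun setT g ->
  (forall x, 0 <= f x) -> (forall x, 0 <= g x) ->
  (Lnorm mu r%:E (fun x => (f x * g x)%:E) <=
   Lnorm mu p%:E (EFin \o f) * Lnorm mu q%:E (EFin \o g))%E.
Proof.
move=> p0 q0 r0 pqr mf mg f0 g0.
have mpow (h : T -> R) : measurable_fun setT h -> measurable_fun setT (fun x => h x `^ r).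
  by move=> mh; exact: (measurableT_comp (measurable_powR r)).
have pqr1 : (p / r)^-1 + (q / r)^-1 = 1.
  by rewrite !invf_div -mulrDr pqr mulfV// gt_eqF.
have := hoelder mu (mpow f mf) (mpow g mg) (divr_gt0 p0 r0) (divr_gt0 q0 r0) pqr1.
have normE (s : R) (h : T -> R) : 0 < s -> (forall x, 0 <= h x) ->
    Lnorm mu (s / r)%:E (fun x => (h x `^ r)%:E) = (Lnorm mu s%:E (EFin \o h) `^ r)%E.
  move=> s0 h0; rewrite unlock /= -poweRrM invf_div [r / s]mulrC; congr (_ `^ _)%E.
  apply: eq_integral => x _ /=; congr EFin.
  rewrite ger0_norm ?powR_ge0// ger0_norm// -powRrM (_ : r * (s / r) = s)//.
  by rewrite mulrC divfK// gt_eqF.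
rewrite (normE p f)// (normE q g)//.
rewrite (_ : 'N[mu]_1[_]%E = (Lnorm mu r%:E (fun x => (f x * g x)%:E) `^ r)%E); last first.
  rewrite -{1}(mulfV (lt0r_neq0 r0)) -normE//; last by move=> x; rewrite mulr_ge0.
  by apply: eq_Lnorm => x /=; rewrite powRM.
rewrite -poweRM ?Lnorm_ge0// => H.
have rK (x : \bar R) : (0 <= x)%E -> ((x `^ r) `^ r^-1)%E = x.
  by move=> x0; rewrite -poweRrM mulfV ?gt_eqF// poweRe1.
rewrite -[leLHS]rK ?Lnorm_ge0// -[leRHS]rK ?mule_ge0 ?Lnorm_ge0//.
apply: gt0_ler_poweR H; first by rewrite invr_ge0 ltW.
- by rewrite in_itv/= leey andbT poweR_ge0.
- by rewrite in_itv/= leey andbT poweR_ge0.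
Qed.

End generalized_hoelder.

(** * Strong measurability and $L^p$ for extended seminorms *)

Section seminorm_valued.
Context {R : realType} {d : measure_display} {Omega : measurableType d}.
Variable P : probability Omega R.

(* N may take the value +oo; the normed space is {v | N v < +oo}. *)
Definition is_seminorm (V : zmodType) (N : V -> \bar R) : Prop :=
  [/\ N 0 = 0%E, forall v, (0 <= N v)%E,
      forall u v, (N (u + v)%R <= N u + N v)%E & forall v, N (- v)%R = N v].

Section one_seminorm.
Context {V : zmodType} {N : V -> \bar R}.
Hypothesis snN : is_seminorm N.

Let N0 : N 0 = 0%E. Proof. by case: snN. Qed.
Let Nge0 v : (0 <= N v)%E. Proof. by case: snN. Qed.
Let ND u v : (N (u + v)%R <= N u + N v)%E. Proof. by case: snN. Qed.
Let NN v : N (- v)%R = N v. Proof. by case: snN. Qed.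

Lemma measurable_simple_comp d' (T' : measurableType d') (f : V -> T') (s : Omega -> V) :
  simple_map N s -> measurable_fun setT (f \o s).
Proof.
move=> [fs ms _] _ B mB; rewrite setTI.
rewrite (_ : _ @^-1` B = \bigcup_(v in range s `&` f @^-1` B) s @^-1` [set v]).
  by apply: fin_bigcup_measurable => //; exact: finite_setIl.
apply/seteqP; split => w /= => [Bw|[v [_ Bv] /= ->]//].
by exists (s w) => //; split => //; exists w.
Qed.

Lemma seminorm_cvg (u : nat -> V) (v : V) : (N v < +oo)%E ->
  N (u k - v) @[k --> \oo] --> 0%E -> N (u k) @[k --> \oo] --> N v.
Proof.
move=> vfin uv.
have vf : N v \is a fin_num by rewrite ge0_fin_numE.
have uvP : (N v + N (u k - v)%R)%E @[k --> \oo] --> N v.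
  by rewrite -[X in _ --> X]adde0; apply: cvgeD => //; [rewrite fin_num_adde_defr|exact: cvg_cst].
have uvM : (N v - N (u k - v)%R)%E @[k --> \oo] --> N v.
  rewrite -[X in _ --> X]sube0; apply: cvgeB => //; [rewrite fin_num_adde_defr//|exact: cvg_cst].
apply: squeeze_cvge uvM uvP; apply: nearW => k; apply/andP; split.
  (* Finitely many differences may have infinite seminorm; the lower bound is then [-oo]. *)
  have [->|uvy] := eqVneq (N (u k - v)) +oo%E; first by rewrite addeNy leNye.
  rewrite leeBlDr ?ge0_fin_numE ?ltey// -{1}(subrK (u k) v) addrC.
  by apply: le_trans (ND _ _) _; rewrite -(opprB (u k)) NN.
by rewrite -{1}(subrK v (u k)) addrC; exact: ND.
Qed.

Lemma measurable_seminorm (X : Omega -> V) :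
  strongly_measurable N X -> measurable_fun setT (N \o X).
Proof.
move=> [Xfin [s ss sX]].
apply: (emeasurable_fun_cvg (fun k => N \o s k)) => [k|w _].
  exact: measurable_simple_comp.
exact: seminorm_cvg.
Qed.

Lemma simple_strongly_measurable (s : Omega -> V) :
  simple_map N s -> strongly_measurable N s.
Proof.
move=> ss; split; first by case: ss.
exists (fun=> s) => // w; under eq_fun do rewrite subrr N0.
exact: cvg_cst.
Qed.

Lemma simple_map_cst (v : V) : (N v < +oo)%E -> simple_map N (cst v : Omega -> V).
Proof.
move=> vfin; split => [|u|//]; first exact: finite_image_cst.
by rewrite preimage_cst; case: ifPn => _; [exact: measurableT|exact: measurable0].
Qed.

End one_seminorm.

Section two_seminorms.
Context {V1 V2 V : zmodType} {N1 : V1 -> \bar R} {N2 : V2 -> \bar R} {N : V -> \bar R}.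
Variable B : V1 -> V2 -> V.
Hypothesis Bfin : forall x y, (N1 x < +oo)%E -> (N2 y < +oo)%E -> (N (B x y) < +oo)%E.

Lemma simple_map2 (s : Omega -> V1) (t : Omega -> V2) :
  simple_map N1 s -> simple_map N2 t -> simple_map N (fun w => B (s w) (t w)).
Proof.
move=> [fs ms Ns] [ft mt Nt]; split => [||w]; last exact: Bfin.
  apply: (@sub_finite_set _ _ ((fun z => B z.1 z.2) @` (range s `*` range t))).
    by move=> _ [w _ <-]; exists (s w, t w) => //; split; exists w.
  by apply: finite_image; exact: finite_setX.
move=> v; rewrite (_ : _ @^-1` _ = \bigcup_(z in (range s `*` range t) `&`
    [set z | B z.1 z.2 = v]) (s @^-1` [set z.1] `&` t @^-1` [set z.2])).
  apply: fin_bigcup_measurable => [|z _]; last exact: measurableI.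
  by apply: finite_setIl; exact: finite_setX.
apply/seteqP; split => w /= => [Bv|[z [_ Bz] [/= -> ->]]//].
by exists (s w, t w) => //=; split => //; split; exists w.
Qed.

Hypothesis Bcvg : forall (x_ : nat -> V1) (y_ : nat -> V2) x y,
  (N1 x < +oo)%E -> (N2 y < +oo)%E ->
  N1 (x_ k - x) @[k --> \oo] --> 0%E -> N2 (y_ k - y) @[k --> \oo] --> 0%E ->
  N (B (x_ k) (y_ k) - B x y) @[k --> \oo] --> 0%E.

(** [B] is applied to the approximating simple maps; sums, opposites and bilinear maps are all
    instances. *)
Lemma strongly_measurable2 (X : Omega -> V1) (Y : Omega -> V2) :
  strongly_measurable N1 X -> strongly_measurable N2 Y ->
  strongly_measurable N (fun w => B (X w) (Y w)).
Proof.
move=> [Xf [s ss sX]] [Yf [t tt tY]]; split => [w|]; first exact: Bfin.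
exists (fun k w => B (s k w) (t k w)) => [k|w]; first exact: simple_map2.
exact: Bcvg.
Qed.

End two_seminorms.

Section Lp_seminorm.
Context {V : zmodType} {N : V -> \bar R}.
Hypothesis snN : is_seminorm N.

Let N0 : N 0 = 0%E. Proof. by case: snN. Qed.
Let Nge0 v : (0 <= N v)%E. Proof. by case: snN. Qed.
Let ND u v : (N (u + v)%R <= N u + N v)%E. Proof. by case: snN. Qed.
Let NN v : N (- v)%R = N v. Proof. by case: snN. Qed.

Lemma strongly_measurableD (X Y : Omega -> V) :
  strongly_measurable N X -> strongly_measurable N Y -> strongly_measurable N (X + Y).
Proof.
apply: strongly_measurable2 => [x y xf yf|x_ y_ x y xf yf xc yc].
  by apply: le_lt_trans (ND _ _) _; exact: lte_add_pinfty.
have xyc : N (x_ k - x) + N (y_ k - y) @[k --> \oo] --> 0%E.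
  by rewrite -[X in _ --> X]adde0; exact: cvgeD.
apply: squeeze_cvge (cvg_cst _) xyc; apply: nearW => k; rewrite Nge0/=.
by rewrite opprD addrACA; exact: ND.
Qed.

Lemma strongly_measurableN (X : Omega -> V) :
  strongly_measurable N X -> strongly_measurable N (- X).
Proof.
move=> mX; apply: (@strongly_measurable2 V V V N N N (fun x _ => - x) _ _ X X) => //.
  by move=> x y xf _; rewrite NN.
move=> x_ y_ x y _ _ xc _; under eq_fun do rewrite -opprD NN.
exact: xc.
Qed.

Lemma strongly_measurableB (X Y : Omega -> V) :
  strongly_measurable N X -> strongly_measurable N Y -> strongly_measurable N (X - Y).
Proof. by move=> mX mY; apply: strongly_measurableD => //; exact: strongly_measurableN. Qed.

Lemma strongly_measurable_sum I (r : seq I) (X : I -> Omega -> V) :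
  (forall i, strongly_measurable N (X i)) -> strongly_measurable N (\sum_(i <- r) X i).
Proof.
move=> mX; elim/big_ind : _ => //; last by move=> ? ? ? ?; exact: strongly_measurableD.
apply: (simple_strongly_measurable snN); apply: simple_map_cst.
by rewrite N0.
Qed.

(** Passage to real-valued functions, for which the Minkowski and Hoelder inequalities are
    stated. *)
Lemma fine_seminorm (X : Omega -> V) : strongly_measurable N X ->
  [/\ N \o X = EFin \o (fine \o N \o X), measurable_fun setT (fine \o N \o X)
    & forall w, 0 <= fine (N (X w))].
Proof.
move=> mX; have XE : N \o X = EFin \o (fine \o N \o X).
  by apply/funext => w /=; rewrite fineK// ge0_fin_numE//; case: mX.
split => //; last by move=> w; exact: fine_ge0.
by apply/measurable_EFinP; rewrite -XE; exact: measurable_seminorm.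
Qed.

Lemma Lp_normD (p : R) (X Y : Omega -> V) : 1 <= p ->
  strongly_measurable N X -> strongly_measurable N Y ->
  (Lp_norm P N p (X + Y)%R <= Lp_norm P N p X + Lp_norm P N p Y)%E.
Proof.
move=> p1 mX mY; have [XE fX X0] := fine_seminorm mX; have [YE fY Y0] := fine_seminorm mY.
rewrite /Lp_norm XE YE; apply: le_trans (minkowski_EFin _ fX fY p1).
apply: le_Lnorm.
- exact: lt_le_trans p1.
- exact/measurable_seminorm/strongly_measurableD.
- by apply/measurable_EFinP; exact: measurable_funD.
- by move=> w /=; exact: Nge0.
- move=> w; apply: le_trans (ND (X w) (Y w)) _.
  by rewrite -[N (X w)]/((N \o X) w) -[N (Y w)]/((N \o Y) w) XE YE.
Qed.

Lemma in_LpD (p : R) (X Y : Omega -> V) : 1 <= p ->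
  in_Lp P N p X -> in_Lp P N p Y -> in_Lp P N p (X + Y).
Proof.
move=> p1 [mX Xp] [mY Yp]; split; first exact: strongly_measurableD.
by apply: le_lt_trans (Lp_normD p1 mX mY) _; exact: lte_add_pinfty.
Qed.

Lemma cvg_LpD (p : R) (X_ Y_ : nat -> Omega -> V) (X Y : Omega -> V) : 1 <= p ->
  (forall k, strongly_measurable N (X_ k)) -> (forall k, strongly_measurable N (Y_ k)) ->
  strongly_measurable N X -> strongly_measurable N Y ->
  cvg_Lp P N p X_ X -> cvg_Lp P N p Y_ Y -> cvg_Lp P N p (fun k => X_ k + Y_ k) (X + Y).
Proof.
move=> p1 mX_ mY_ mX mY cX cY.
have cXY : (Lp_norm P N p (X_ k - X)%R + Lp_norm P N p (Y_ k - Y)%R)%E @[k --> \oo] --> 0%E.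
  by rewrite -[X in _ --> X]adde0; exact: cvgeD.
apply: squeeze_cvge (cvg_cst _) cXY; apply: nearW => k; rewrite Lnorm_ge0/=.
by rewrite opprD addrACA; apply: Lp_normD => //; exact: strongly_measurableB.
Qed.

End Lp_seminorm.

(** * Bounded bilinear maps from $L^p\times L^q$ to $L^r$ *)

Section bilinear_estimate.
Context {V1 V2 V : zmodType} {N1 : V1 -> \bar R} {N2 : V2 -> \bar R} {N : V -> \bar R}.
Hypothesis sn1 : is_seminorm N1.
Hypothesis sn2 : is_seminorm N2.
Hypothesis sn : is_seminorm N.
Variables (B : V1 -> V2 -> V) (C : R).
Hypothesis BBl : forall x x' y, B (x - x') y = B x y - B x' y.
Hypothesis BBr : forall x y y', B x (y - y') = B x y - B x y'.
Hypothesis C0 : 0 <= C.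
Hypothesis bndB : forall x y, (N1 x < +oo)%E -> (N2 y < +oo)%E ->
  (N (B x y) <= C%:E * (N1 x * N2 y))%E.

Let N10 x : (0 <= N1 x)%E. Proof. by case: sn1. Qed.
Let N20 x : (0 <= N2 x)%E. Proof. by case: sn2. Qed.
Let Nge0 x : (0 <= N x)%E. Proof. by case: sn. Qed.

(** Each term contains an increment, and the other factor is an increment or a fixed limit, so no
    uniform bound on the approximants has to be established. *)
Let bilinear_diff x x' y y' :
  B x' y' - B x y = B (x' - x) (y' - y) + B (x' - x) y + B x (y' - y).
Proof.
by rewrite !BBl !BBr [X in _ = X + _]addrAC subrK subrKA.
Qed.

Let estimate_cvg (a_ b_ : nat -> \bar R) (a b : \bar R) :
  (a < +oo)%E -> (b < +oo)%E -> (0 <= a)%E -> (0 <= b)%E ->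
  a_ k @[k --> \oo] --> 0%E -> b_ k @[k --> \oo] --> 0%E ->
  (C%:E * (a_ k * b_ k) + C%:E * (a_ k * b) + C%:E * (a * b_ k))%E @[k --> \oo] --> 0%E.
Proof.
move=> afin bfin a0 b0 ca cb.
have af : a \is a fin_num by rewrite ge0_fin_numE.
have bf : b \is a fin_num by rewrite ge0_fin_numE.
have -> : (0 = C%:E * (0 * 0) + C%:E * (0 * b) + C%:E * (a * 0) :> \bar R)%E.
  by rewrite !mul0e !mule0 !adde0.
apply: cvgeD; first by rewrite !mul0e !mule0 !adde0.
  apply: cvgeD; first by rewrite !mul0e !mule0.
    by apply: cvgeZl => //; apply: cvgeM.
  by apply: cvgeZl => //; apply: cvgeZr.
by apply: cvgeZl => //; apply: cvgeZl.
Qed.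

Lemma bilinear_fin x y : (N1 x < +oo)%E -> (N2 y < +oo)%E -> (N (B x y) < +oo)%E.
Proof.
move=> xf yf; apply: le_lt_trans (bndB xf yf) _.
have xF : N1 x \is a fin_num by rewrite ge0_fin_numE.
have yF : N2 y \is a fin_num by rewrite ge0_fin_numE.
by rewrite ltey_eq !fin_numM.
Qed.

Let ND3 u v w : (N (u + v + w)%R <= N u + N v + N w)%E.
Proof.
case: sn => _ _ ND _; apply: le_trans (ND _ _) _.
by apply: leeD2r; exact: ND.
Qed.

Lemma strongly_measurable_bilinear (X : Omega -> V1) (Y : Omega -> V2) :
  strongly_measurable N1 X -> strongly_measurable N2 Y ->
  strongly_measurable N (fun w => B (X w) (Y w)).
Proof.
apply: strongly_measurable2 => [|x_ y_ x y xf yf xc yc]; first exact: bilinear_fin.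
(* Convergence to 0 makes the seminorms of the increments eventually finite, as [bndB] requires. *)
have [/= finx _] := (fine_cvgP _ _).1 xc; have [/= finy _] := (fine_cvgP _ _).1 yc.
apply: squeeze_cvge (cvg_cst _) (estimate_cvg xf yf (N10 x) (N20 y) xc yc).
near=> k; rewrite Nge0/=.
have xk : (N1 (x_ k - x) < +oo)%E by rewrite -ge0_fin_numE//; near: k.
have yk : (N2 (y_ k - y) < +oo)%E by rewrite -ge0_fin_numE//; near: k.
rewrite bilinear_diff; apply: le_trans (ND3 _ _ _) _.
by apply: leeD; [apply: leeD|]; exact: bndB.
Unshelve. all: by end_near. Qed.

Lemma Lp_norm_bilinear (p q r : R) (X : Omega -> V1) (Y : Omega -> V2) :
  0 < p -> 0 < q -> 0 < r -> p^-1 + q^-1 = r^-1 ->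
  strongly_measurable N1 X -> strongly_measurable N2 Y ->
  (Lp_norm P N r (fun w => B (X w) (Y w)) <= C%:E * (Lp_norm P N1 p X * Lp_norm P N2 q Y))%E.
Proof.
move=> p0 q0 r0 pqr mX mY.
have [XE fX X0] := fine_seminorm sn1 mX; have [YE fY Y0] := fine_seminorm sn2 mY.
have mXY := strongly_measurable_bilinear mX mY.
rewrite /Lp_norm XE YE.
apply: le_trans (lee_wpmul2l _ (hoelder_Lnorm P p0 q0 r0 pqr fX fY X0 Y0)); last by rewrite lee_fin.
have mXY' : measurable_fun setT (fun w => (fine (N1 (X w)) * fine (N2 (Y w)))%:E).
  by apply/measurable_EFinP; exact: measurable_funM.
rewrite -(LnormZ P r0 C0 mXY'); last by move=> w; rewrite lee_fin; exact: mulr_ge0 (X0 w) (Y0 w).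
apply: le_Lnorm => //.
- exact: measurable_seminorm.
- exact: emeasurable_funM.
- by move=> w /=; exact: Nge0.
- move=> w; rewrite EFinM.
  rewrite -[(fine (N1 _))%:E]/((EFin \o (fine \o N1 \o X)) w) -XE.
  rewrite -[(fine (N2 _))%:E]/((EFin \o (fine \o N2 \o Y)) w) -YE.
  by apply: bndB; [case: mX|case: mY].
Qed.

Lemma in_Lp_bilinear (p q r : R) (X : Omega -> V1) (Y : Omega -> V2) :
  0 < p -> 0 < q -> 0 < r -> p^-1 + q^-1 = r^-1 ->
  in_Lp P N1 p X -> in_Lp P N2 q Y -> in_Lp P N r (fun w => B (X w) (Y w)).
Proof.
move=> p0 q0 r0 pqr [mX Xp] [mY Yq]; split; first exact: strongly_measurable_bilinear.
apply: le_lt_trans (Lp_norm_bilinear p0 q0 r0 pqr mX mY) _.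
have XF : Lp_norm P N1 p X \is a fin_num by rewrite ge0_fin_numE// Lnorm_ge0.
have YF : Lp_norm P N2 q Y \is a fin_num by rewrite ge0_fin_numE// Lnorm_ge0.
by rewrite ltey_eq !fin_numM.
Qed.

(** The three terms of [bilinear_diff] are estimated by Hoelder; [1 <= r] serves the triangle
    inequality in $L^r$. *)
Lemma cvg_Lp_bilinear (p q r : R) (X_ : nat -> Omega -> V1) (Y_ : nat -> Omega -> V2)
    (X : Omega -> V1) (Y : Omega -> V2) :
  1 <= p -> 1 <= q -> 1 <= r -> p^-1 + q^-1 = r^-1 ->
  (forall k, strongly_measurable N1 (X_ k)) -> (forall k, strongly_measurable N2 (Y_ k)) ->
  in_Lp P N1 p X -> in_Lp P N2 q Y ->
  cvg_Lp P N1 p X_ X -> cvg_Lp P N2 q Y_ Y ->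
  cvg_Lp P N r (fun k w => B (X_ k w) (Y_ k w)) (fun w => B (X w) (Y w)).
Proof.
move=> p1 q1 r1 pqr mX_ mY_ [mX Xp] [mY Yq] cX cY.
have [p0 q0 r0] : [/\ 0 < p, 0 < q & 0 < r] by split; exact: lt_le_trans ltr01 _.
apply: squeeze_cvge (cvg_cst _) (estimate_cvg Xp Yq (Lnorm_ge0 _ _ _) (Lnorm_ge0 _ _ _) cX cY).
apply: nearW => k; rewrite Lnorm_ge0/=.
have mXk : strongly_measurable N1 (X_ k - X) by exact: strongly_measurableB.
have mYk : strongly_measurable N2 (Y_ k - Y) by exact: strongly_measurableB.
rewrite (_ : (fun w => _) - _ = (fun w => B ((X_ k - X) w) ((Y_ k - Y) w)) +
    (fun w => B ((X_ k - X) w) (Y w)) + (fun w => B (X w) ((Y_ k - Y) w))); last first.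
  by apply/funext => w; exact: bilinear_diff.
have mB := strongly_measurable_bilinear.
apply: le_trans (Lp_normD sn r1 _ _) _.
- by apply: (strongly_measurableD sn); apply: mB.
- by apply: mB.
apply: leeD; last exact: Lp_norm_bilinear.
apply: le_trans (Lp_normD sn r1 _ _) _; [exact: mB|exact: mB|].
by apply: leeD; exact: Lp_norm_bilinear.
Qed.

End bilinear_estimate.

End seminorm_valued.

(** * The Leibniz rule for smooth random variables *)

Section tensor_functions.
Context {R : realType} {n m : nat}.
Implicit Types (f : 'rV[R]_n -> R) (g : 'rV[R]_m -> R).

(** The factors read disjoint blocks of coordinates, so each partial derivative meets only one of
    them. *)
Definition tensor_fun f g (a : 'rV[R]_(n + m)) : R := f (lsubmx a) * g (rsubmx a).

Lemma continuous_lsubmx : continuous (@lsubmx R 1 n m).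
Proof.
move=> a s /= /(nbhs_ballP (lsubmx a)) [e e0 es].
apply/nbhs_ballP; exists e => //= c [_ ac]; apply: es; split => // i j.
by rewrite !mxE; exact: ac.
Qed.

Lemma continuous_rsubmx : continuous (@rsubmx R 1 n m).
Proof.
move=> a s /= /(nbhs_ballP (rsubmx a)) [e e0 es].
apply/nbhs_ballP; exists e => //= c [_ ac]; apply: es; split => // i j.
by rewrite !mxE; exact: ac.
Qed.

Lemma continuous_tensor f g : continuous f -> continuous g -> continuous (tensor_fun f g).
Proof.
move=> cf cg a.
have cfl : {for a, continuous (f \o lsubmx)}.
  by apply: continuous_comp; [exact: continuous_lsubmx|exact: cf].
have cgr : {for a, continuous (g \o rsubmx)}.
  by apply: continuous_comp; [exact: continuous_rsubmx|exact: cg].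
exact: (cvgM cfl cgr).
Qed.

Lemma bounded_tensor f g : bounded_fun f -> bounded_fun g -> bounded_fun (tensor_fun f g).
Proof.
move=> [M [Mr fM]] [M' [Mr' gM]].
(* [bounded_fun] gives bounds only strictly above [M] and [M'], hence the added 1. *)
exists ((`|M| + 1) * (`|M'| + 1)); split; first exact: num_real.
move=> K MK a _; apply: le_trans (ltW MK); rewrite normrM ler_pM//.
- by apply: fM => //; rewrite (le_lt_trans (ler_norm _))// ltrDl.
- by apply: gM => //; rewrite (le_lt_trans (ler_norm _))// ltrDl.
Qed.

Let delta_l (i : 'I_n) : delta_mx 0 (lshift m i) = row_mx (delta_mx 0 i) 0 :> 'rV[R]_(n + m).
Proof.
apply/rowP => k; case: (split_ordP k) => j ->.
  by rewrite row_mxEl !mxE eq_lshift.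
by rewrite row_mxEr !mxE eq_rlshift andbF.
Qed.

Let delta_r (i : 'I_m) : delta_mx 0 (rshift n i) = row_mx 0 (delta_mx 0 i) :> 'rV[R]_(n + m).
Proof.
apply/rowP => k; case: (split_ordP k) => j ->.
  by rewrite row_mxEl !mxE eq_lrshift andbF.
by rewrite row_mxEr !mxE eq_rshift.
Qed.

Let lsubmxDZ (a : 'rV[R]_(n + m)) (t : R) (u : 'rV[R]_n) (v : 'rV[R]_m) :
  lsubmx (t *: row_mx u v + a) = t *: u + lsubmx a.
Proof. by apply/rowP => k; rewrite !mxE (unsplitK (inl k)). Qed.

Let rsubmxDZ (a : 'rV[R]_(n + m)) (t : R) (u : 'rV[R]_n) (v : 'rV[R]_m) :
  rsubmx (t *: row_mx u v + a) = t *: v + rsubmx a.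
Proof. by apply/rowP => k; rewrite !mxE (unsplitK (inr k)). Qed.

Lemma is_derive_tensor_l f g (i : 'I_n) (a : 'rV[R]_(n + m)) :
  derivable f (lsubmx a) (delta_mx 0 i) ->
  is_derive a (delta_mx 0 (lshift m i)) (tensor_fun f g) (tensor_fun (partial i f) g a).
Proof.
move=> df.
have cv : (fun t : R => t^-1 *: ((tensor_fun f g \o shift a) (t *: delta_mx 0 (lshift m i)) -
     tensor_fun f g a)) @ 0^' --> tensor_fun (partial i f) g a.
  rewrite (_ : (fun t : R => _) = (fun t : R =>
     t^-1 *: ((f \o shift (lsubmx a)) (t *: delta_mx 0 i) - f (lsubmx a)) * g (rsubmx a))); last first.
    apply/funext => t; rewrite /tensor_fun/= delta_l lsubmxDZ rsubmxDZ scaler0 add0r.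
    by rewrite -mulrBl scalerAl.
  by apply: cvgMl; exact: df.
by apply: DeriveDef; [apply/cvg_ex; exists (tensor_fun (partial i f) g a)|exact: cvg_lim].
Qed.

Lemma is_derive_tensor_r f g (i : 'I_m) (a : 'rV[R]_(n + m)) :
  derivable g (rsubmx a) (delta_mx 0 i) ->
  is_derive a (delta_mx 0 (rshift n i)) (tensor_fun f g) (tensor_fun f (partial i g) a).
Proof.
move=> dg.
have cv : (fun t : R => t^-1 *: ((tensor_fun f g \o shift a) (t *: delta_mx 0 (rshift n i)) -
     tensor_fun f g a)) @ 0^' --> tensor_fun f (partial i g) a.
  rewrite (_ : (fun t : R => _) = (fun t : R => f (lsubmx a) *
     (t^-1 *: ((g \o shift (rsubmx a)) (t *: delta_mx 0 i) - g (rsubmx a))))); last first.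
    apply/funext => t; rewrite /tensor_fun/= delta_r lsubmxDZ rsubmxDZ scaler0 add0r.
    by rewrite -mulrBr scalerAr.
  by apply: cvgMr; exact: dg.
by apply: DeriveDef; [apply/cvg_ex; exists (tensor_fun f (partial i g) a)|exact: cvg_lim].
Qed.

Lemma partial_tensor_l f g (i : 'I_n) : (forall a, derivable f a (delta_mx 0 i)) ->
  partial (lshift m i) (tensor_fun f g) = tensor_fun (partial i f) g.
Proof.
by move=> df; apply/funext => a; have [] := is_derive_tensor_l g (df (lsubmx a)).
Qed.

Lemma partial_tensor_r f g (i : 'I_m) : (forall a, derivable g a (delta_mx 0 i)) ->
  partial (rshift n i) (tensor_fun f g) = tensor_fun f (partial i g).
Proof.
by move=> dg; apply/funext => a; have [] := is_derive_tensor_r f (dg (rsubmx a)).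
Qed.

(** Every iterated partial derivative is again a single tensor product: the indices in [s] are
    sorted into those acting on [f] and those acting on [g]. *)
Lemma Cb_infty_tensor f g : Cb_infty f -> Cb_infty g -> Cb_infty (tensor_fun f g).
Proof.
move=> Cf Cg s.
have [sl [sr ->]] : exists sl sr, iter_partial s (tensor_fun f g) =
    tensor_fun (iter_partial sl f) (iter_partial sr g).
  elim: s => [|i s [sl [sr IH]]]; first by exists [::], [::].
  have [_ _ dl] := Cf sl; have [_ _ dr] := Cg sr.
  rewrite /iter_partial/= -/(iter_partial _ _) IH.
  case: (split_ordP i) => j ->.
    by exists (j :: sl), sr; rewrite partial_tensor_l.
  by exists sl, (j :: sr); rewrite partial_tensor_r.
have [cl bl dl] := Cf sl; have [cr br dr] := Cg sr.
split; [exact: continuous_tensor|exact: bounded_tensor|move=> i a].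
case: (split_ordP i) => j ->.
  by have [] := is_derive_tensor_l (iter_partial sr g) (dl j (lsubmx a)).
by have [] := is_derive_tensor_r (iter_partial sl f) (dr j (rsubmx a)).
Qed.

End tensor_functions.

(** * Sums and products of smooth random variables *)

Section smooth_random_variables.
Context {R : realType} {d : measure_display} {Omega : measurableType d}.
Variable P : probability Omega R.
Context {H : normedModType R} (ip : {dot H for idfun}).
Variable W : H -> {RV P >-> R}.

Section closure.
Context {E : normedModType R}.
Implicit Types (F : Omega -> E) (X : Omega -> H -> E).

Lemma smooth_derivative_elementary F X :
  elementary_derivative ip W F X -> smooth_derivative ip W F X.
Proof. by move=> FX; exists 1%N, (fun=> F), (fun=> X); rewrite !big_ord1. Qed.

Lemma smooth_derivativeD F F' X X' :
  smooth_derivative ip W F X -> smooth_derivative ip W F' X' ->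
  smooth_derivative ip W (F + F') (X + X').
Proof.
move=> [m [F_ [X_ [FX -> ->]]]] [m' [F'_ [X'_ [FX' -> ->]]]].
exists (m + m')%N, (fun k : 'I_(m + m') => match fintype.split k with inl i => F_ i | inr j => F'_ j end),
  (fun k : 'I_(m + m') => match fintype.split k with inl i => X_ i | inr j => X'_ j end); split.
- by move=> k; case: (fintype.split k).
- rewrite big_split_ord/=; congr (_ + _); apply: eq_bigr => i _.
    by rewrite (unsplitK (inl i)).
  by rewrite (unsplitK (inr i)).
- rewrite big_split_ord/=; congr (_ + _); apply: eq_bigr => i _.
    by rewrite (unsplitK (inl i)).
  by rewrite (unsplitK (inr i)).
Qed.

Lemma smooth_derivative_sum I (r : seq I) (F_ : I -> Omega -> E) (X_ : I -> Omega -> H -> E) :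
  (forall i, smooth_derivative ip W (F_ i) (X_ i)) ->
  smooth_derivative ip W (\sum_(i <- r) F_ i) (\sum_(i <- r) X_ i).
Proof.
move=> FX; elim/big_ind2 : _ => //; last by move=> *; exact: smooth_derivativeD.
by exists 0, (fun=> 0), (fun=> 0); split => [[]//| |]; rewrite big_ord0.
Qed.

End closure.

Section product_rule.
Context {E0 E1 E2 : normedModType R} (b : {bilinear E0 -> E1 -> E2}).

Definition leibniz (F : Omega -> E0) (X : Omega -> H -> E0) (G : Omega -> E1)
    (Y : Omega -> H -> E1) : Omega -> H -> E2 :=
  fun w h => b (X w h) (G w) + b (F w) (Y w h).

(** The families [h] and [k] are concatenated. The first [n] partial derivatives of the tensor
    product produce [b (X w h') (G w)], the last [m] produce [b (F w) (Y w h')]. *)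
Lemma elementary_leibniz F X G Y :
  elementary_derivative ip W F X -> elementary_derivative ip W G Y ->
  elementary_derivative ip W (fun w => b (F w) (G w)) (leibniz F X G Y).
Proof.
move=> [n [h [f [x [Cf -> ->]]]]] [m [k [g [y [Cg -> ->]]]]].
pose hk (i : 'I_(n + m)) := match fintype.split i with inl j => h j | inr j => k j end.
have hkl j : hk (lshift m j) = h j by rewrite /hk (unsplitK (inl j)).
have hkr j : hk (rshift n j) = k j by rewrite /hk (unsplitK (inr j)).
have Wl w : lsubmx (W_vector W hk w) = W_vector W h w.
  by apply/rowP => j; rewrite !mxE hkl.
have Wr w : rsubmx (W_vector W hk w) = W_vector W k w.
  by apply/rowP => j; rewrite !mxE hkr.
exists (n + m)%N, hk, (tensor_fun f g), (b x y); split.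
- exact: Cb_infty_tensor.
- by apply/funext => w; rewrite /tensor_fun Wl Wr linearZl_LR linearZr_LR scalerA.
have [_ _ df] := Cf [::]; have [_ _ dg] := Cg [::].
apply/funext => w; apply/funext => h'; rewrite /leibniz big_split_ord/=.
rewrite -[RHS]/(_ h' + _ h') !fct_sumE; congr (_ + _).
  rewrite linear_sumlz; apply: eq_bigr => i _.
  rewrite partial_tensor_l; last exact: df.
  rewrite /tensor_fun Wl Wr hkl /rank_one !fctE !linearZl_LR linearZr_LR !scalerA/=.
  by congr (_ *: _); rewrite mulrAC.
rewrite linear_sumr; apply: eq_bigr => i _.
rewrite partial_tensor_r; last exact: dg.
rewrite /tensor_fun Wl Wr hkr /rank_one !fctE !linearZr_LR linearZl_LR !scalerA/=.
by congr (_ *: _); rewrite mulrC mulrA.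
Qed.

Lemma smooth_leibniz F X G Y :
  smooth_derivative ip W F X -> smooth_derivative ip W G Y ->
  smooth_derivative ip W (fun w => b (F w) (G w)) (leibniz F X G Y).
Proof.
move=> [m [F_ [X_ [FX -> ->]]]] [m' [G_ [Y_ [GY -> ->]]]].
rewrite (_ : (fun w => _) = \sum_(i < m) \sum_(j < m') (fun w => b (F_ i w) (G_ j w))); last first.
  apply/funext => w; rewrite !fct_sumE linear_sumlz; apply: eq_bigr => i _.
  by rewrite fct_sumE linear_sumr.
rewrite (_ : leibniz _ _ _ _ = \sum_(i < m) \sum_(j < m') leibniz (F_ i) (X_ i) (G_ j) (Y_ j)); last first.
  apply/funext => w; apply/funext => h; rewrite /leibniz !fct_sumE linear_sumlz.
  rewrite linear_sumlz -big_split; apply: eq_bigr => i _ /=.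
  rewrite !fct_sumE !linear_sumr -big_split; apply: eq_bigr => j _ //=.
by do 2 (apply: smooth_derivative_sum => ?); apply: smooth_derivative_elementary; exact: elementary_leibniz.
Qed.

End product_rule.

End smooth_random_variables.

(** * The Banach norm and the gamma norm as extended seminorms *)

Section concrete_seminorms.
Context {R : realType} {H : normedModType R} (ip : {dot H for idfun}).
Context {E : normedModType R}.

Lemma banach_norm_seminorm : is_seminorm (@banach_norm R E).
Proof.
split => [|v|u v|v]; rewrite /banach_norm.
- by rewrite normr0.
- by rewrite lee_fin.
- by rewrite -EFinD lee_fin ler_normD.
- by rewrite normrN.
Qed.

(** The ideal property for multiplication by [a]; with [a = -1], used twice, it gives the symmetry
    of the gamma norm. *)
Lemma gamma_normZ (a : R) (T : H -> E) :
  (gamma_norm ip (a *: T) <= `|a|%:E * gamma_norm ip T)%E.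
Proof.
apply: (@gamma_norm_comp R H ip E E ( *:%R a) `|a|) => // [c u v|x].
  by rewrite scalerDr !scalerA mulrC.
by rewrite normrZ.
Qed.

Lemma gamma_norm_seminorm : is_seminorm (gamma_norm ip : (H -> E) -> \bar R).
Proof.
have N_le T : (gamma_norm ip (- T)%R <= gamma_norm ip (T : H -> E))%E.
  by rewrite -scaleN1r; apply: le_trans (gamma_normZ _ _) _; rewrite normrN1 mul1e.
split => [|v|u v|v].
- exact: gamma_norm0.
- exact: gamma_norm_ge0.
- exact: gamma_normD.
- by apply/eqP; rewrite eq_le N_le -{1}(opprK v) N_le.
Qed.

End concrete_seminorms.

(** * Strong measurability of smooth random variables *)

Section strongly_measurable_functions.
Context {R : realType} {d : measure_display} {Omega : measurableType d}.

Let absR (x : R) : \bar R := `|x|%:E.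

Let absR_seminorm : is_seminorm absR.
Proof.
split => [|v|u v|v]; rewrite /absR.
- by rewrite normr0.
- by rewrite lee_fin.
- by rewrite -EFinD lee_fin ler_normD.
- by rewrite normrN.
Qed.

Import HBNNSimple.

Let strongly_measurable_nonneg (f : Omega -> R) :
  measurable_fun setT f -> (forall w, 0 <= f w) -> strongly_measurable absR f.
Proof.
move=> mf f0; split => [w|]; first exact: ltry.
have mEf : measurable_fun setT (EFin \o f) by exact/measurable_EFinP.
have [g [_ gf]] := approximation measurableT mEf (fun w _ => f0 w).
exists g => [k|w].
  split => [|v|w]; [exact: fimfunP|exact: measurable_sfunP|exact: ltry].
have gw : g k w @[k --> \oo] --> f w by exact: ((fine_cvgP _ _).1 (gf w I)).2.
rewrite /absR; apply: cvg_EFin; first exact: nearW.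
rewrite -(normr0 R); apply: cvg_norm; rewrite -(subrr (f w)).
by apply: cvgB => //; exact: cvg_cst.
Qed.

Let strongly_measurable_real (f : Omega -> R) :
  measurable_fun setT f -> strongly_measurable absR f.
Proof.
move=> mf; rewrite -(funrposBneg f); apply: (strongly_measurableB absR_seminorm).
  by apply: strongly_measurable_nonneg => [|w]; [exact: measurable_funrpos|exact: funrpos_ge0].
by apply: strongly_measurable_nonneg => [|w]; [exact: measurable_funrneg|exact: funrneg_ge0].
Qed.

Context {V : lmodType R} {N : V -> \bar R}.
Hypothesis snN : is_seminorm N.
Hypothesis NZ : forall a v, (N (a *: v) <= `|a|%:E * N v)%E.

(** Scalar multiplication is a bilinear map bounded by 1, applied to [f] and a constant map. *)
Lemma strongly_measurableZ (f : Omega -> R) (v : V) : measurable_fun setT f ->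
  (N v < +oo)%E -> strongly_measurable N (fun w => f w *: v).
Proof.
move=> mf vfin.
apply: (@strongly_measurable_bilinear _ _ _ R V V absR N N absR_seminorm snN snN
  (fun a u => a *: u) 1 _ _ _ f (cst v)) => //.
- by move=> x x' y; rewrite scalerBl.
- by move=> x y y'; rewrite scalerBr.
- by move=> x y _ _; rewrite mul1e; exact: NZ.
- exact: strongly_measurable_real.
- by apply: (simple_strongly_measurable snN); exact: simple_map_cst.
Qed.

End strongly_measurable_functions.

Section smooth_strongly_measurable.
Context {R : realType} {d : measure_display} {Omega : measurableType d}.
Variable P : probability Omega R.
Context {H : normedModType R} (ip : {dot H for idfun}).
Variable W : H -> {RV P >-> R}.
Context {E : normedModType R}.

Lemma measurable_W_vector n (h : 'I_n -> H) (f : 'rV[R]_n -> R) : continuous f ->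
  measurable_fun setT (fun w => f (W_vector W h w)).
Proof.
by move=> cf; apply: (@measurable_continuous_coordinates R _ Omega n (fun i => W (h i))).
Qed.

(** [F] and [X] are finite sums of measurable scalar functions times fixed vectors or rank one
    operators. *)
Lemma smooth_strongly_measurable (F : Omega -> E) (X : Omega -> H -> E) :
  smooth_derivative ip W F X ->
  strongly_measurable banach_norm F /\ strongly_measurable (gamma_norm ip) X.
Proof.
move=> [m [F_ [X_ [FX -> ->]]]].
suff smFX k : strongly_measurable banach_norm (F_ k) /\
    strongly_measurable (gamma_norm ip) (X_ k).
  split; [apply: (strongly_measurable_sum banach_norm_seminorm)|
    apply: (strongly_measurable_sum (gamma_norm_seminorm ip))] => k;
  by have [] := smFX k.
have [n [h [f [x [Cf -> ->]]]]] := FX k; split.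
  apply: (strongly_measurableZ banach_norm_seminorm) => [a v||].
  - by rewrite /banach_norm normrZ.
  - by apply: measurable_W_vector; have [] := Cf [::].
  - exact: ltry.
rewrite (_ : (fun w => _) = \sum_(i < n) (fun w => partial i f (W_vector W h w) *: rank_one ip (h i) x)).
  apply: (strongly_measurable_sum (gamma_norm_seminorm ip)) => i.
  apply: (strongly_measurableZ (gamma_norm_seminorm ip)).
  - exact: gamma_normZ.
  - by apply: measurable_W_vector; have [] := Cf [:: i].
  - exact/gamma_norm_finite_rank_lty/finite_rank_rank_one.
by apply/funext => w; elim/big_rec2 : _ => // i u v _ ->.
Qed.

End smooth_strongly_measurable.

(** * Closing the graph of the derivative *)

Theorem lemma3p6 (R : realType)
  (H : completeNormedModType R) (ip : {dot H for idfun})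
  (H_hilbert : induces_norm ip) (H_separable : separable H)
  (d : measure_display) (Omega : measurableType d) (P : probability Omega R)
  (W : H -> {RV P >-> R})
  (W_isonormal : isonormal ip W) (W_generates : generated_by_W W)
  (E0 E1 E2 : completeNormedModType R)
  (b : {bilinear E0 -> E1 -> E2})
  (C : R) (b_bounded : forall x y, `|b x y| <= C * `|x| * `|y|)
  (p q r : R) (p_ge1 : 1 <= p) (q_ge1 : 1 <= q) (r_ge1 : 1 <= r)
  (pqr : p^-1 + q^-1 = r^-1)
  (F : Omega -> E0) (DF : Omega -> H -> E0)
  (G : Omega -> E1) (DG : Omega -> H -> E1)
  (F_dom : malliavin_derivative ip W p F DF)
  (G_dom : malliavin_derivative ip W q G DG) :
  malliavin_derivative ip W r
    (fun w => b (F w) (G w))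
    (fun w h => b (DF w h) (G w) + b (F w) (DG w h)).
Proof.
(* The sign of [C] is not prescribed, while the estimates need a nonnegative constant. *)
have bB x y : `|b x y| <= `|C| * `|x| * `|y|.
  by rewrite (le_trans (b_bounded x y))// -!mulrA ler_wpM2r ?ler_norm// mulr_ge0.
have bnd0 (x : E0) (y : E1) : (banach_norm x < +oo)%E -> (banach_norm y < +oo)%E ->
    (banach_norm (b x y) <= `|C|%:E * (banach_norm x * banach_norm y))%E.
  by move=> _ _; rewrite /banach_norm -!EFinM lee_fin mulrA.
(* For fixed [y] the map [b ^~ y] is linear with bound [|C| * |y|], so this is the ideal
   property. *)
have bndl (T : H -> E0) (y : E1) : (gamma_norm ip T < +oo)%E -> (banach_norm y < +oo)%E ->
    (gamma_norm ip (fun h => b (T h) y) <= `|C|%:E * (gamma_norm ip T * banach_norm y))%E.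
  move=> _ _; rewrite [X in (_ * X)%E]muleC muleA -EFinM.
  apply: (@gamma_norm_comp R H ip E0 E2 (b ^~ y) (`|C| * `|y|)).
  - by move=> a u v; exact: linearPl.
  - by rewrite mulr_ge0.
  - by move=> x; rewrite mulrAC.
have bndr (x : E0) (T : H -> E1) : (banach_norm x < +oo)%E -> (gamma_norm ip T < +oo)%E ->
    (gamma_norm ip (fun h => b x (T h)) <= `|C|%:E * (banach_norm x * gamma_norm ip T))%E.
  move=> _ _; rewrite muleA -EFinM.
  by apply: (@gamma_norm_comp R H ip E1 E2 (b x)) => // a u v; exact: linearPr.
have sn0 := @banach_norm_seminorm R E0; have sn1 := @banach_norm_seminorm R E1.
have sn2 := @banach_norm_seminorm R E2.
have gn0 := @gamma_norm_seminorm R H ip E0; have gn1 := @gamma_norm_seminorm R H ip E1.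
have gn2 := @gamma_norm_seminorm R H ip E2.
pose bl (T : H -> E0) (y : E1) : H -> E2 := fun h => b (T h) y.
pose br (x : E0) (T : H -> E1) : H -> E2 := fun h => b x (T h).
have [p0 q0 r0] : [/\ 0 < p, 0 < q & 0 < r] by split; exact: lt_le_trans ltr01 _.
have b_l x x' y : b (x - x') y = b x y - b x' y by exact: linearBl.
have b_r x y y' : b x (y - y') = b x y - b x y' by exact: linearBr.
have bl_l T T' y : bl (T - T') y = bl T y - bl T' y by apply/funext => h; exact: b_l.
have bl_r T y y' : bl T (y - y') = bl T y - bl T y' by apply/funext => h; exact: b_r.
have br_l x x' T : br (x - x') T = br x T - br x' T by apply/funext => h; exact: b_l.
have br_r x T T' : br x (T - T') = br x T - br x T' by apply/funext => h; exact: b_r.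
have C0 : 0 <= `|C| by [].
have [FLp DFLp [F_ [X_ [FX_ cF cX]]]] := F_dom.
have [GLq DGLq [G_ [Y_ [GY_ cG cY]]]] := G_dom.
have mF k : strongly_measurable banach_norm (F_ k) by have [] := smooth_strongly_measurable (FX_ k).
have mX k : strongly_measurable (gamma_norm ip) (X_ k) by have [] := smooth_strongly_measurable (FX_ k).
have mG k : strongly_measurable banach_norm (G_ k) by have [] := smooth_strongly_measurable (GY_ k).
have mY k : strongly_measurable (gamma_norm ip) (Y_ k) by have [] := smooth_strongly_measurable (GY_ k).
have inl := in_Lp_bilinear gn0 sn1 gn2 bl_l bl_r C0 bndl p0 q0 r0 pqr DFLp GLq.
have inr := in_Lp_bilinear sn0 gn1 gn2 br_l br_r C0 bndr p0 q0 r0 pqr FLp DGLq.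
have [minl _] := inl; have [minr _] := inr.
split.
- exact: (in_Lp_bilinear sn0 sn1 sn2 b_l b_r C0 bnd0 p0 q0 r0 pqr FLp GLq).
- exact: (in_LpD gn2 r_ge1 inl inr).
(* The products of the given approximants, paired with their exact derivatives, approximate the pair
   in the graph. *)
exists (fun k w => b (F_ k w) (G_ k w)), (fun k => leibniz b (F_ k) (X_ k) (G_ k) (Y_ k)); split.
- by move=> k; exact: smooth_leibniz.
- exact: (cvg_Lp_bilinear sn0 sn1 sn2 b_l b_r C0 bnd0 p_ge1 q_ge1 r_ge1 pqr mF mG FLp GLq cF cG).
have mbl k := strongly_measurable_bilinear gn0 sn1 gn2 bl_l bl_r bndl (mX k) (mG k).
have mbr k := strongly_measurable_bilinear sn0 gn1 gn2 br_l br_r bndr (mF k) (mY k).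
apply: (cvg_LpD gn2 r_ge1 mbl mbr minl minr).
- exact: (cvg_Lp_bilinear gn0 sn1 gn2 bl_l bl_r C0 bndl p_ge1 q_ge1 r_ge1 pqr mX mG DFLp GLq cX cG).
- exact: (cvg_Lp_bilinear sn0 gn1 gn2 br_l br_r C0 bndr p_ge1 q_ge1 r_ge1 pqr mF mY FLp DGLq cF cY).
Qed.
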